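(* Let $(A,\phi)$ be a noncommutative probability space and assume that the unital subalgebras $A_i\subset A$, $i\in I$, are $\epsilon$-independent. Let $d\in I^{[n]}$ and $a_j\in A_{d(j)}$ for $1\le j\le n$, and write $\mathbf a=(a_1,\dots,a_n)$. Then $$\phi(a_1\cdots a_n)=\sum_{\Gamma\in\mathcal P_n^{d,\epsilon},\ \Gamma\le\ker d}k_\epsilon^\Gamma(\mathbf a),$$ where, for each such $\Gamma$, $k_\epsilon^\Gamma(\mathbf a)$ is a product of classical and free cumulants according to the blocks of $\Gamma$: a block $V$ of $\Gamma$ all of whose elements have decoration $i$ contributes as factor the classical cumulant of $(a_v)_{v\in V}$ (in increasing order) if $\epsilon_{ii}=1$, and the free cumulant of $(a_v)_{v\in V}$ (in increasing order) if $\epsilon_{ii}=0$.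
   Context: $\mathbb K$ is a field of characteristic zero. A noncommutative probability space $(A,\phi)$ is an associative unital $\mathbb K$-algebra $A$ with a linear functional $\phi:A\to\mathbb K$, $\phi(1_A)=1$. $I$ is a (finite or infinite) index set, $\epsilon_{ij}=\epsilon_{ji}\in\{0,1\}$ for $i,j\in I$; the diagonal values $\epsilon_{ii}$ are arbitrary in $\{0,1\}$. $[n]=\{1,\dots,n\}$. $\epsilon$-independence. $I_n^\epsilon$ is the set of $n$-tuples $(i(1),\dots,i(n))\in I^n$ such that whenever $i(k)=i(l)$ with $1\le k<l\le n$, there exists $k<p<l$ with $i(p)\neq i(k)$ and $\epsilon_{i(p)i(k)}=0$. Unital subalgebras $A_i\subset A$ (sharing the unit $1_A$), $i\in I$, are $\epsilon$-independent iff (1) $A_i$ and $A_j$ commute for all $i\ne j$ with $\epsilon_{ij}=1$, and (2) for all $n\ge 1$, $(i(1),\dots,i(n))\in I_n^\epsilon$ and $(a_1,\dots,a_n)\in A_{i(1)}\times\cdots\times A_{i(n)}$ with $\phi(a_k)=0$ for all $k$, one has $\phi(a_1\cdots a_n)=0$. Decorated partitions. A decoration is a map $d:[n]\to I$. A $d$-decorated partition of $[n]$ is a set partition $\Gamma=\Gamma_1\coprod\cdots\coprod\Gamma_k$ of $[n]$ (blocks non-empty), each $j\in[n]$ carrying the decoration $d(j)$; $\mathcal P_n^d$ is the set of these, ordered by refinement ($\Gamma\le\Theta$ if $\Gamma$ is finer than $\Theta$). $\ker d$ is the partition of $[n]$ whose blocks are the non-empty sets $d^{-1}(\{i\})$,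 $i\in I$. For $\sigma\in S_n$, $\sigma(\Gamma)$ is the partition with blocks $\sigma(\Gamma_i)$, decorated by $\sigma(d):=d\circ\sigma^{-1}$. For a decorated partition of a finite set $X=\{x_1<\dots<x_n\}$ of integers with decoration $d:X\to I$, its standardization $st$ is the decorated partition of $[n]$ obtained by relabelling $x_j\mapsto j$, with decoration $st(d)(j)=d(x_j)$. Allowed moves. For $\Gamma\in\mathcal P_n^d$, the transposition $\tau_i=(i,i+1)$ is an allowed move, from $\Gamma$ to the $\tau_i(d)$-decorated partition $\tau_i(\Gamma)$, if $\epsilon_{d(i)d(i+1)}=1$ and either $d(i)\ne d(i+1)$, or $d(i)=d(i+1)$ and $i,i+1$ belong to different blocks of $\Gamma$. A permutation $\sigma=\tau_{i_k}\cdots\tau_{i_1}$ (possibly the empty product) is an allowed permutation of $\Gamma$ if each $\tau_{i_j}$ is an allowed move from $\tau_{i_{j-1}}\cdots\tau_{i_1}(\Gamma)$ to $\tau_{i_j}\cdots\tau_{i_1}(\Gamma)$. $\epsilon$-noncrossing partitions. A reduction of $\Gamma$ is a pair $(\sigma,i)$ with $\sigma$ an allowed permutation of $\Gamma$ and $i$ such that $\sigma(\Gamma_i)$ is an interval (set of consecutive integers) in $[n]$; it reduces $\Gamma$ to the standardization of the decorated partition obtained from $\sigma(\Gamma)$ by deleting the block $\sigma(\Gamma_i)$. $\Gamma$ is $\epsilon$-noncrossing if it can be reduced to the empty partition by a sequence of reductions. $\mathcal P_n^{d,\epsilon}\subset\mathcal P_n^d$ is the subset of $\epsilon$-noncrossing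 partitions. $\epsilon$-cumulants. For every $n\ge1$ and $d\in I^{[n]}$, $k_\epsilon$ is the linear map $A_{d(1)}\otimes\cdots\otimes A_{d(n)}\to\mathbb K$ (written $k_\epsilon(a_1,\dots,a_n)$; it depends on the decoration $d$) defined inductively by $$\phi(a_1\cdots a_n)=\sum_{\Gamma\in\mathcal P_n^{d,\epsilon}}k_\epsilon^\Gamma(a_1,\dots,a_n),$$ where $k_\epsilon^\Gamma(a_1,\dots,a_n)=\prod_{V\text{ block of }\Gamma}k_\epsilon(a_V)$ and, for $V=\{v_1<\dots<v_p\}$, $k_\epsilon(a_V)=k_\epsilon(a_{v_1},\dots,a_{v_p})$ with the decoration restricted from $d$. Classical (resp. free) cumulants are the multilinear functionals $c$ on tuples of elements of $A$ defined inductively by $\phi(a_1\cdots a_n)=\sum_{\Gamma}\prod_{V\in\Gamma}c(a_V)$, where $\Gamma$ runs over all partitions (resp. all noncrossing partitions) of $[n]$ and $c(a_V)=c(a_{v_1},\dots,a_{v_p})$ for $V=\{v_1<\dots<v_p\}$. A partition is noncrossing if there are no $i<j<k<l$ with $i,k$ in one block and $j,l$ in a different block. *)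

(* Defs.v *)
From HB Require Import structures.
From mathcomp Require Import all_boot all_order all_fingroup all_algebra.
From mathcomp Require Import boolp.

Set Implicit Arguments.
Unset Strict Implicit.
Unset Printing Implicit Defensive.

Import GRing.Theory.
Local Open Scope ring_scope.

(* Conventions: [n] is 'I_n (counted from 0), a decoration of [n] is a function
   'I_n -> I, and a set partition of [n] is a G : {set {set 'I_n}} such that
   partition G [set: 'I_n]. *)

Section EpsIndependence.
Variables (K : fieldType) (A : algType K) (phi : {scalar A}).
Variables (I : eqType) (eps : I -> I -> bool).

Definition eps_reduced n (i : 'I_n -> I) : Prop :=
  forall k l : 'I_n, (k < l)%N -> i k = i l ->
  exists p : 'I_n, [/\ (k < p < l)%N, i p != i k & ~~ eps (i p) (i k)].

Definition eps_independent (B : I -> {pred A}) : Prop :=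
  (forall i j, i != j -> eps i j ->
     forall x y, x \in B i -> y \in B j -> x * y = y * x) /\
  (forall n (i : 'I_n -> I) (a : 'I_n -> A), (0 < n)%N -> eps_reduced i ->
     (forall k, a k \in B (i k)) -> (forall k, phi (a k) = 0) ->
     phi (\prod_(k < n) a k) = 0).

End EpsIndependence.

(* The family (f x)_(x in X) reindexed by 'I_#|X| in increasing order:
   enum_val enumerates a subset of 'I_n increasingly. *)
Definition restr T n (X : {set 'I_n}) (f : 'I_n -> T) : 'I_#|X| -> T :=
  fun j => f (enum_val j).

Definition refines n (G H : {set {set 'I_n}}) : bool :=
  [forall V in G, [exists W in H, V \subset W]].

Definition noncrossing n (G : {set {set 'I_n}}) : bool :=
  [forall V in G, forall W in G, (V != W) ==>
    [forall i in V, forall j in W, forall k in V, forall l in W,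
       ~~ [&& (i < j)%N, (j < k)%N & (k < l)%N]]].

Definition is_interval n (V : {set 'I_n}) : Prop :=
  exists a b : nat, V = [set j : 'I_n | (a <= j < b)%N].

Definition perm_part n (s : {perm 'I_n}) (G : {set {set 'I_n}}) :
    {set {set 'I_n}} :=
  [set s @: V | V : {set 'I_n} in G].

Definition perm_deco I n (s : {perm 'I_n}) (d : 'I_n -> I) : 'I_n -> I :=
  fun j => d ((s^-1)%g j).

(* The blocks of G other than W, relabelled increasingly by 'I_#|~: W|. *)
Definition std_delete n (G : {set {set 'I_n}}) (W : {set 'I_n}) :
    {set {set 'I_#|~: W|}} :=
  [set [set j | enum_val j \in V] | V : {set 'I_n} in G :\ W].

Section EpsNoncrossing.
Variables (I : eqType) (eps : I -> I -> bool).

Definition allowed_move n (d : 'I_n -> I) (G : {set {set 'I_n}})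
    (i i' : 'I_n) : Prop :=
  [/\ i' = i.+1 :> nat, eps (d i) (d i') &
      d i != d i' \/ (d i = d i' /\ pblock G i != pblock G i')].

(* (s * t)%g is "first s, then t", i.e. the composite t \o s. *)
Inductive allowed_perm n (d : 'I_n -> I) (G : {set {set 'I_n}}) :
    {perm 'I_n} -> Prop :=
| allowed_perm1 : allowed_perm d G 1%g
| allowed_permM s i i' : allowed_perm d G s ->
    allowed_move (perm_deco s d) (perm_part s G) i i' ->
    allowed_perm d G (s * tperm i i')%g.

Inductive eps_reducible :
    forall n : nat, ('I_n -> I) -> {set {set 'I_n}} -> Prop :=
| eps_reducible_nil (d : 'I_0 -> I) : eps_reducible d set0
| eps_reducible_step n (d : 'I_n -> I) (G : {set {set 'I_n}})
    (s : {perm 'I_n}) (V : {set 'I_n}) :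
    allowed_perm d G s -> V \in G -> is_interval (s @: V) ->
    eps_reducible (restr (X := ~: (s @: V)) (perm_deco s d))
                  (std_delete (perm_part s G) (s @: V)) ->
    eps_reducible d G.

Definition eps_nc n (d : 'I_n -> I) (G : {set {set 'I_n}}) : bool :=
  partition G [set: 'I_n] && `[< eps_reducible d G >].

End EpsNoncrossing.

(* Cumulants relative to a class S of decorated partitions: the functions k
   determined by the moment-cumulant formula (lemma cumulant_moment below)
     phi (a_1 ... a_n) = \sum_(G in S) \prod_(V in G) k (a_V),   n >= 1,
   solved for the term of the one-block partition.  The recursion goes through
   a fuel argument, as the blocks of the other partitions are smaller. *)
Section Cumulants.
Variables (K : fieldType) (A : algType K) (phi : {scalar A}) (I : Type).
Variable S : forall n, ('I_n -> I) -> {set {set 'I_n}} -> bool.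

Fixpoint cumulant_rec (m n : nat) (d : 'I_n -> I) (a : 'I_n -> A) : K :=
  if m is m'.+1 then
    phi (\prod_(j < n) a j) -
    \sum_(G : {set {set 'I_n}} | S d G && (G != [set [set: 'I_n]]))
      \prod_(V in G) cumulant_rec m' (restr (X := V) d) (restr (X := V) a)
  else 0.

Definition cumulant n (d : 'I_n -> I) (a : 'I_n -> A) : K :=
  cumulant_rec n d a.

Definition cumulant_part n (d : 'I_n -> I) (a : 'I_n -> A)
    (G : {set {set 'I_n}}) : K :=
  \prod_(V in G) cumulant (restr (X := V) d) (restr (X := V) a).

Hypothesis S_partition : forall n (d : 'I_n -> I) G,
  S d G -> partition G [set: 'I_n].
Hypothesis S_full : forall n (d : 'I_n -> I),
  (0 < n)%N -> S d [set [set: 'I_n]].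

Lemma block_card_lt n (G : {set {set 'I_n}}) V :
  partition G [set: 'I_n] -> G != [set [set: 'I_n]] -> V \in G ->
  (0 < #|V| < n)%N.
Proof.
move=> partG GT VG.
have V0 : V != set0.
  by apply: contraTneq VG => ->; case/and3P: partG.
rewrite card_gt0 V0 /= -[X in (_ < X)%N]card_ord -cardsT.
apply: proper_card; rewrite properEneq subsetT andbT.
apply: contraNneq GT => VT; rewrite VT in VG V0.
apply/eqP/setP=> W; rewrite inE; apply/idP/eqP => [WG|->//].
case/and3P: partG => _ /trivIsetP tI G0.
apply/eqP/negPn/negP => WT; have := tI _ _ WG VG WT.
rewrite -setI_eq0 setIT => /eqP W0; by rewrite -W0 WG in G0.
Qed.

Lemma cumulant_recE m n (d : 'I_n -> I) (a : 'I_n -> A) :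
  (n <= m)%N -> (0 < n)%N -> cumulant_rec m d a = cumulant d a.
Proof.
rewrite /cumulant.
have [N] := ubnP n; elim: N => // N IH in m n d a *.
case: n => // n in d a *; rewrite ltnS => nN; case: m => // m nm _ /=.
congr (_ - _); apply: eq_bigr => G /andP[SG GT]; apply: eq_bigr => V VG.
have /andP[V0 Vn] := block_card_lt (S_partition SG) GT VG.
rewrite !ltnS in nm Vn.
rewrite IH //; [|exact: leq_ltn_trans nN|exact: leq_trans nm].
by rewrite [RHS]IH //; exact: leq_ltn_trans nN.
Qed.

Lemma enum_val_setT n (j : 'I_#|[set: 'I_n]|) : enum_val j = j :> nat.
Proof.
have jn : (j < n)%N by rewrite -[X in (_ < X)%N]card_ord -cardsT ltn_ord.
rewrite (enum_val_nth (Ordinal jn)) enum_setT -enumT.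
exact: nth_enum_ord.
Qed.

Lemma cumulant_restrT n (d : 'I_n -> I) (a : 'I_n -> A) :
  cumulant (restr (X := [set: 'I_n]) d) (restr (X := [set: 'I_n]) a) =
  cumulant d a.
Proof.
have e : #|[set: 'I_n]| = n by rewrite cardsT card_ord.
have E T (f : 'I_n -> T) :
    restr (X := [set: 'I_n]) f = fun j => f (cast_ord e j).
  apply: funext => j; rewrite /restr; congr f.
  by apply: val_inj; rewrite /= enum_val_setT.
rewrite !E {E}; move: e; move: #|_| => m e; subst m.
by congr cumulant; apply: funext => j; rewrite cast_ord_id.
Qed.

Lemma cumulant_moment n (d : 'I_n -> I) (a : 'I_n -> A) : (0 < n)%N ->
  phi (\prod_(j < n) a j) =
  \sum_(G : {set {set 'I_n}} | S d G) cumulant_part d a G.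
Proof.
move=> n0; rewrite (bigD1 [set [set: 'I_n]]) ?S_full //=.
rewrite {1}/cumulant_part big_set1 cumulant_restrT.
case: n => // n in d a n0 *; rewrite {1}/cumulant /=.
rewrite -[LHS](subrK (\sum_(G | S d G && (G != [set [set: 'I_n.+1]]))
  cumulant_part d a G)).
congr (_ - _ + _); apply: eq_bigr => G /andP[SG GT]; apply: eq_bigr => V VG.
have /andP[V0 Vn] := block_card_lt (S_partition SG) GT VG.
by rewrite cumulant_recE.
Qed.

End Cumulants.

Section Instances.
Variables (K : fieldType) (A : algType K) (phi : {scalar A}).

Definition eps_cumulant (I : eqType) (eps : I -> I -> bool) n
    (d : 'I_n -> I) (a : 'I_n -> A) : K :=
  cumulant phi (@eps_nc I eps) d a.

Definition eps_cumulant_part (I : eqType) (eps : I -> I -> bool) n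
    (d : 'I_n -> I) (a : 'I_n -> A) (G : {set {set 'I_n}}) : K :=
  \prod_(V in G) eps_cumulant eps (restr (X := V) d) (restr (X := V) a).

Definition classical_cumulant n (a : 'I_n -> A) : K :=
  cumulant phi (fun m (_ : 'I_m -> unit) G => partition G [set: 'I_m])
    (fun=> tt) a.

Definition free_cumulant n (a : 'I_n -> A) : K :=
  cumulant phi
    (fun m (_ : 'I_m -> unit) G => partition G [set: 'I_m] && noncrossing G)
    (fun=> tt) a.

Lemma partition_full n : (0 < n)%N -> partition [set [set: 'I_n]] [set: 'I_n].
Proof.
move=> n0; rewrite /partition /trivIset /cover !big_set1 !eqxx /=.
by rewrite inE eq_sym -card_gt0 cardsT card_ord.
Qed.

Lemma eps_nc_full (I : eqType) (eps : I -> I -> bool) n (d : 'I_n -> I) :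
  (0 < n)%N -> eps_nc eps d [set [set: 'I_n]].
Proof.
move=> n0; rewrite /eps_nc partition_full //=; apply/asboolP.
have sT (s : {perm 'I_n}) : s @: [set: 'I_n] = setT.
  by apply/setP => x; rewrite inE -[x](permKV s) imset_f ?inE.
apply: (@eps_reducible_step _ _ _ _ _ 1%g [set: 'I_n]).
- exact: allowed_perm1.
- by rewrite inE.
- by exists 0%N, n; rewrite sT; apply/setP => x; rewrite !inE /= ltn_ord.
rewrite /std_delete /perm_part imset_set1 setDv imset0.
move: (restr _); move: (1%g : {perm 'I_n}) (sT 1%g) => s ->.
rewrite setCT; move: (cards0 'I_n); move: #|_| => m m0; subst m => d'.
exact: eps_reducible_nil.
Qed.

Lemma eps_cumulant_moment (I : eqType) (eps : I -> I -> bool) n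
    (d : 'I_n -> I) (a : 'I_n -> A) : (0 < n)%N ->
  phi (\prod_(j < n) a j) =
  \sum_(G : {set {set 'I_n}} | eps_nc eps d G) eps_cumulant_part eps d a G.
Proof.
move=> n0; apply: cumulant_moment => //.
- by move=> m d' G /andP[].
- by move=> m d'; exact: eps_nc_full.
Qed.

Lemma classical_cumulant_moment n (a : 'I_n -> A) : (0 < n)%N ->
  phi (\prod_(j < n) a j) =
  \sum_(G : {set {set 'I_n}} | partition G [set: 'I_n])
     \prod_(V in G) classical_cumulant (restr (X := V) a).
Proof.
move=> n0; rewrite (cumulant_moment (I := unit)
  (S := fun m _ G => partition G [set: 'I_m]) phi _ _ (fun=> tt)) //.
by move=> m d; exact: partition_full.
Qed.

Lemma free_cumulant_moment n (a : 'I_n -> A) : (0 < n)%N ->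
  phi (\prod_(j < n) a j) =
  \sum_(G : {set {set 'I_n}} | partition G [set: 'I_n] && noncrossing G)
     \prod_(V in G) free_cumulant (restr (X := V) a).
Proof.
move=> n0; rewrite (cumulant_moment (I := unit)
  (S := fun m _ G => partition G [set: 'I_m] && noncrossing G)
  phi _ _ (fun=> tt)) //.
- by move=> m d G /andP[].
move=> m d m0; rewrite partition_full //=.
apply/forall_inP => V /set1P ->; apply/forall_inP => W /set1P ->.
by rewrite eqxx.
Qed.

End Instances.

(* Main.v *)
Require Import Defs.
From HB Require Import structures.
From mathcomp Require Import all_boot all_order all_fingroup all_algebra.
From mathcomp Require Import boolp zify.

Set Implicit Arguments.
Unset Strict Implicit.
Unset Printing Implicit Defensive.

Import GRing.Theory.
Local Open Scope ring_scope.

(** The statement rests on three facts about set partitions each of whose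
    blocks carries a single colour (decoration).

    Crossings decide (eps_ncE).  Such a partition is eps-noncrossing if and
    only if any two blocks that cross have colours i, j with eps i j = 1.  An
    allowed move only exchanges neighbours whose colours are related by eps,
    and an interval crosses nothing, so reductions neither create nor destroy
    a forbidden crossing.  Conversely, if there is no forbidden crossing, then
    every point of another block that a block V of minimal span encloses can be
    moved across V, so V can be made an interval and deleted.  For a constant
    decoration i the eps-noncrossing partitions are therefore all partitions
    if eps i i = 1 and the noncrossing ones otherwise, which identifies the
    eps-cumulants of one colour with the classical, resp. free, cumulants.

    Summing out one colour (sum_color).  Fix a colour c and the blocks H of
    the other colours.  The blocks of H whose colour is not eps-related to c
    sort the points of colour c into classes, two points being equivalent when
    no such block separates them cyclically; a partition of these points is
    compatible with H exactly when its blocks lie inside classes.  The classes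
    do not cross each other, so the sum over the compatible partitions splits
    into a product over the classes, and by the moment-cumulant formula in one
    colour each factor is the moment of the class.

    Induction (moment_cumulant_sum).  Both the moment and the sum over
    colour-respecting eps-noncrossing partitions are defined for every subset X
    of the positions, and they are shown to agree by induction on #|X|.  If the
    word on X is not reduced, two letters of the same colour have between them
    only letters that commute with them; writing their product at the
    first place and 1 at the second changes neither side, and a letter 1 can be
    omitted.  If it is reduced, linearity in each letter and induction reduce
    to centred letters.  Then the moment vanishes by eps-independence, and so
    does the sum, because every partition in it has a singleton block. *)

(** * Sums over partitions of a disjoint union *)

Section Partitions.
Variable T : finType.
Implicit Types (G H P : {set {set T}}) (X S R V W : {set T}).

Lemma partitionPP G X :
  reflect [/\ forall V, V \in G -> exists x, x \in V,
              forall V x, V \in G -> x \in V -> x \in X,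
              forall x, x \in X -> exists2 V, V \in G & x \in V
            & forall V W x, V \in G -> W \in G -> x \in V -> x \in W -> V = W]
          (partition G X).
Proof.
apply: (iffP and3P) => [[/eqP covG /trivIsetP tiG G0]|[ne sub cov inj]].
  split.
  - by move=> V VG; apply/set0Pn; apply: contraNneq G0 => <-.
  - by move=> V x VG xV; rewrite -covG; apply/bigcupP; exists V.
  - by move=> x; rewrite -covG => /bigcupP[V VG xV]; exists V.
  - move=> V W x VG WG xV xW; apply/eqP/negPn/negP => VW.
    by have /pred0P/(_ x)/= := tiG _ _ VG WG VW; rewrite xV xW.
split.
- apply/eqP/setP => x; apply/bigcupP/idP => [[V VG xV]|]; first exact: sub xV.
  by move=> /cov[V VG xV]; exists V.
- apply/trivIsetP => V W VG WG /eqP VW; apply/pred0P => x /=.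
  by apply/andP => -[xV xW]; apply: VW; exact: inj xV xW.
- by apply/negP => /ne[x]; rewrite inE.
Qed.

Lemma partitionU H P R S : [disjoint R & S] ->
  partition H R -> partition P S -> partition (H :|: P) (R :|: S).
Proof.
move=> dRS /partitionPP[neH subH covH injH] /partitionPP[neP subP covP injP].
have dis x : x \in R -> x \in S -> False.
  by move=> xR xS; have /pred0P/(_ x)/= := dRS; rewrite xR xS.
apply/partitionPP; split.
- by move=> V /setUP[/neH|/neP].
- move=> V x /setUP[VH|VP] xV; rewrite inE; first by rewrite (subH _ _ VH xV).
  by rewrite (subP _ _ VP xV) orbT.
- move=> x /setUP[/covH|/covP][V VG xV]; exists V => //; rewrite inE VG ?orbT //.
- move=> V W x /setUP[VH|VP] /setUP[WH|WP] xV xW.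
  + exact: injH xV xW.
  + by case: (dis x); [exact: subH xV|exact: subP xW].
  + by case: (dis x); [exact: subH xW|exact: subP xV].
  + exact: injP xV xW.
Qed.

Lemma partition_restrict G R S : [disjoint R & S] ->
  (forall V, V \in G -> V \subset R \/ V \subset S) ->
  partition G (R :|: S) -> partition (G :&: powerset R) R.
Proof.
move=> dRS spl /partitionPP[ne sub cov inj].
apply/partitionPP; split.
- by move=> V /setIP[/ne].
- by move=> V x /setIP[_]; rewrite inE => /subsetP; apply.
- move=> x xR; have /cov[V VG xV] : x \in R :|: S by rewrite inE xR.
  exists V => //; rewrite 2!inE VG /=.
  case: (spl _ VG) => // /subsetP/(_ x xV) xS.
  by have /pred0P/(_ x)/= := dRS; rewrite xR xS.
- by move=> V W x /setIP[VG _] /setIP[WG _]; exact: inj.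
Qed.

Lemma partition_split H P R S : [disjoint R & S] ->
  partition H R -> partition P S -> (H :|: P) :&: powerset R = H.
Proof.
move=> dRS /partitionPP[neH subH _ _] /partitionPP[neP subP _ _].
apply/setP => V; rewrite !inE; apply/idP/idP => [/andP[/orP[//|VP] VR]|VH].
  have [x xV] := neP _ VP; have xS := subP _ _ VP xV.
  by have /pred0P/(_ x)/= := dRS; rewrite xS (subsetP VR _ xV).
by rewrite VH; apply/subsetP => x; exact: subH.
Qed.

Lemma sum_partition_split (K : comPzRingType) (F : {set T} -> K)
    (R S : {set T}) (Q : pred {set {set T}}) : [disjoint R & S] ->
  (forall G, partition G (R :|: S) -> Q G ->
     forall V, V \in G -> V \subset R \/ V \subset S) ->
  \sum_(G | partition G (R :|: S) && Q G) \prod_(V in G) F V =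
  \sum_(H | partition H R) \sum_(P | partition P S && Q (H :|: P))
     (\prod_(V in H) F V) * \prod_(V in P) F V.
Proof.
move=> dRS spl.
have dSR : [disjoint S & R] by rewrite disjoint_sym.
rewrite pair_big_dep /=.
rewrite (reindex_onto (fun p : {set {set T}} * {set {set T}} => p.1 :|: p.2)
  (fun G => (G :&: powerset R, G :&: powerset S))) /=; last first.
  move=> G /andP[pG QG]; rewrite -setIUr; apply/setIidPl/subsetP => V VG.
  by rewrite !inE; apply/orP; exact: spl VG.
have E H P : partition (H :|: P) (R :|: S) && Q (H :|: P) &&
    ((H :|: P) :&: powerset R == H) && ((H :|: P) :&: powerset S == P) =
    partition H R && (partition P S && Q (H :|: P)).
  apply/idP/idP.
    case/andP => /andP[/andP[pG QG] /eqP eH] /eqP eP.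
    have := partition_restrict dRS (spl _ pG QG) pG; rewrite eH => ->.
    have sp' V : V \in H :|: P -> V \subset S \/ V \subset R.
      by case/(spl _ pG QG); [right|left].
    have := partition_restrict dSR sp'; rewrite (setUC S) eP => /(_ pG) ->.
    by rewrite QG.
  case/and3P => pH pP QG; rewrite partitionU // QG (partition_split dRS pH pP) //.
  by rewrite setUC (partition_split dSR pP pH) // !eqxx.
apply: eq_big => [[H P]|[H P]] /=.
  by rewrite xpair_eqE -E !andbA.
rewrite xpair_eqE andbA E => /and3P[pH pP _].
rewrite -bigU //=; first by apply: eq_bigl => V; rewrite inE.
apply/pred0P => V /=; apply/andP => -[VH VP].
move: pH pP => /partitionPP[neH subH _ _] /partitionPP[_ subP _ _].
have [x xV] := neH _ VH.
by have /pred0P/(_ x)/= := dRS; rewrite (subH _ _ VH) // (subP _ _ VP).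
Qed.

End Partitions.

(** * Crossings and gaps *)

Section Crossings.
Variables (T : finType) (I : eqType) (eps : I -> I -> bool).

(** The function d is constant on each block of G. *)
Definition monochromatic (d : T -> I) (G : {set {set T}}) : Prop :=
  forall V x y, V \in G -> x \in V -> y \in V -> d x = d y.

(** With the points placed at the positions pos, blocks that cross have colours
    related by eps.  The placement is a parameter so that a permuted partition
    can be studied without relabelling its blocks. *)
Definition cross_ok (pos : T -> nat) (d : T -> I) (G : {set {set T}}) : Prop :=
  forall V W x y z w, V \in G -> W \in G -> V != W ->
    x \in V -> y \in W -> z \in V -> w \in W ->
    (pos x < pos y)%N -> (pos y < pos z)%N -> (pos z < pos w)%N ->
    eps (d x) (d y).

Lemma cross_ok_sub pos d (G H : {set {set T}}) : H \subset G ->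
  cross_ok pos d G -> cross_ok pos d H.
Proof.
by move=> /subsetP HG gG V W x y z w /HG VG /HG WG; exact: gG.
Qed.

End Crossings.

Section Gaps.
Variable n : nat.
Implicit Types (U : {set 'I_n}) (s t u v w : 'I_n).

(** The gap between cyclically consecutive points of U in which s lies, encoded
    by the points of U below s.  The gap above the last point of U is also the
    one below the first point; this is why the full set U is replaced by the
    empty set. *)
Definition gap U s : {set 'I_n} :=
  let L := [set u in U | (u < s)%N] in if L == U then set0 else L.

(** Points that U does not separate cyclically lie in the same gap. *)
Lemma gap_eq U s t : s \notin U -> t \notin U -> (s < t)%N ->
  (forall u u', u \in U -> u' \in U -> (s < u)%N -> (u < t)%N ->
     (u' < s)%N \/ (t < u')%N -> False) ->
  gap U s = gap U t.
Proof.
move=> sU tU st nocross.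
have neq u r : u \in U -> r \notin U -> (u < r)%N || (r < u)%N.
  move=> uU rU; rewrite -neq_ltn; apply/eqP => /val_inj ur.
  by rewrite -ur uU in rU.
have [/existsP[u /and3P[uU su ut]]|none] :=
    boolP [exists u : 'I_n, [&& u \in U, (s < u)%N & (u < t)%N]].
  have between u' : u' \in U -> (s < u' < t)%N.
    move=> u'U; apply/andP; split.
      have [h|//] := orP (neq _ _ u'U sU).
      by case: (nocross _ _ uU u'U su ut); left.
    have [//|h] := orP (neq _ _ u'U tU).
    by case: (nocross _ _ uU u'U su ut); right.
  have Lt : [set u in U | (u < t)%N] = U.
    apply/setP => r; rewrite inE; apply: andb_idr => rU.
    by case/andP: (between _ rU).
  have Ls : [set u in U | (u < s)%N] = set0.
    apply/setP => r; rewrite !inE; apply/andP => -[rU].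
    by case/andP: (between _ rU) => sr _; rewrite ltnNge ltnW.
  by rewrite /gap Lt Ls eqxx; case: ifP.
suff E : [set u in U | (u < s)%N] = [set u in U | (u < t)%N] by rewrite /gap E.
apply/setP => r; rewrite !inE; case rU: (r \in U) => //=.
apply/idP/idP => [rs|rt]; first exact: ltn_trans st.
have [//|sr] := orP (neq _ _ rU sU).
by case/existsP: none; exists r; rewrite rU sr.
Qed.

Lemma gap_neq U s t u u' : u \in U -> u' \in U -> (s < u)%N -> (u < t)%N ->
  (u' < s)%N \/ (t < u')%N -> gap U s <> gap U t.
Proof.
move=> uU u'U su ut cr.
have nsu : (u < s)%N = false by rewrite ltnNge ltnW.
have Ls : [set u in U | (u < s)%N] == U = false.
  by apply/eqP => /setP/(_ u); rewrite inE uU nsu.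
move=> /setP; rewrite /gap Ls; case: ifP => [Lu|Lt] /=.
  case: cr => [cr /(_ u')|cr]; first by rewrite !inE u'U cr.
  move=> _; move: u'U; rewrite -(eqP Lu) inE => /andP[_].
  by rewrite ltnNge ltnW.
by move=> /(_ u); rewrite !inE uU ut nsu.
Qed.

(** The classes of points cut out by the gaps of U do not cross each other. *)
Lemma gap_nocross U (v v' w w' : 'I_n) : (v < v')%N -> (v' < w)%N -> (w < w')%N ->
  gap U v = gap U w -> gap U v' = gap U w' -> gap U v = gap U v'.
Proof.
rewrite /gap => vv' v'w ww'.
set L := fun s : 'I_n => [set u in U | (u < s)%N].
have LL s t : (s < t)%N -> L s \subset L t.
  move=> st; apply/subsetP => u; rewrite !inE => /andP[-> us].
  exact: ltn_trans st.
have LU s t : (s < t)%N -> L s = U -> L t = U.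
  move=> st sU; apply/eqP; rewrite eqEsubset -{2}sU LL // andbT.
  by apply/subsetP => u; rewrite inE => /andP[].
rewrite -/(L v) -/(L v') -/(L w) -/(L w').
case: eqP => [/(LU _ _ vv') v'U|_]; first by rewrite v'U eqxx.
case: eqP => [/(LU _ _ ww') -> |wU e _]; first by rewrite eqxx => -> ->.
case: eqP => [/(LU _ _ v'w)//|_].
by apply/eqP; rewrite eqEsubset LL // e LL.
Qed.

End Gaps.

(** * Factorization of the sum over one colour *)

Section Factor.
Variables (n : nat) (I : eqType) (eps : I -> I -> bool) (d : 'I_n -> I).
Variables (K : comPzRingType) (wt M : {set 'I_n} -> K).
Notation gd := (cross_ok eps (fun x : 'I_n => val x) d).
Hypothesis moment : forall Z : {set 'I_n},
  (forall x y, x \in Z -> y \in Z -> d x = d y) ->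
  M Z = \sum_(P | partition P Z && `[< gd P >]) \prod_(V in P) wt V.

Lemma moment_set0 : M set0 = 1.
Proof.
rewrite moment => [|x y]; last by rewrite inE.
rewrite (big_pred1 set0) ?big_set0 // => P; rewrite partition_set0.
apply: andb_idr => /eqP ->; apply/asboolP => V W ? ? ? ?.
by rewrite inE.
Qed.

(** If the fibres of g do not cross each other, the sum over the partitions of
    S whose blocks lie inside fibres is the product of the moments of the
    fibres.  Values not taken by g contribute M set0 = 1. *)
Lemma moment_factor (Y : finType) (g : 'I_n -> Y) (S : {set 'I_n}) :
  (forall x y, x \in S -> y \in S -> d x = d y) ->
  (forall v v' w w' : 'I_n, v \in S -> v' \in S -> w \in S -> w' \in S ->
     (v < v')%N -> (v' < w)%N -> (w < w')%N ->
     g v = g w -> g v' = g w' -> g v = g v') ->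
  \sum_(P | partition P S && `[< gd P /\ monochromatic g P >]) \prod_(V in P) wt
    V =
  \prod_(y : Y) M [set x in S | g x == y].
Proof.
have [m] := ubnP #|S|; elim: m S => // m IH S Sm dS gS.
have [->|[s sS]] := set_0Vmem S.
  rewrite [RHS]big1 => [|y _]; last first.
    by rewrite -moment_set0; congr M; apply/setP => x; rewrite !inE.
  rewrite (big_pred1 set0) ?big_set0 // => P; rewrite partition_set0.
  apply: andb_idr => /eqP ->; apply/asboolP; split=> [V W ? ? ? ?|V ? ?];
  by rewrite inE.
pose C := [set x in S | g x == g s]; pose S' := S :\: C.
have dCS : [disjoint C & S'].
  by apply/pred0P => x; rewrite /= !inE; case: (x \in S); case: eqP.
have CS : C \subset S by apply/subsetP => x; rewrite inE => /andP[].
have S'S : S' \subset S by exact: subsetDl.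
have SE : S = C :|: S' by apply/setP => x; rewrite !inE; case: (x \in S);
  case: eqP.
have S'E x : (x \in S') = (x \in S) && (g x != g s).
  by rewrite !inE; case: (x \in S) => //=; rewrite ?andbT ?andbF.
have S'm : (#|S'| < m)%N.
  rewrite -ltnS; apply: leq_trans Sm; rewrite ltnS; apply: proper_card.
  by rewrite properE S'S; apply/subsetPn; exists s; rewrite // S'E eqxx andbF.
rewrite [in LHS]SE sum_partition_split //; last first.
  move=> G /partitionPP[ne sub _ _] /asboolP[_ mG] V VG.
  have [x xV] := ne _ VG; have := sub _ _ VG xV; rewrite -SE => xS.
  have VS y : y \in V -> y \in S by move=> yV; rewrite SE; exact: sub yV.
  case gx: (g x == g s); [left|right]; apply/subsetP => y yV.
    by rewrite inE VS //= (mG _ _ _ VG yV xV).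
  by rewrite S'E VS //= (mG _ _ _ VG yV xV) gx.
have C_mono P : partition P C -> monochromatic g P.
  move=> /partitionPP[_ sub _ _] V x y VP /(sub _ _ VP) + /(sub _ _ VP).
  by rewrite !inE => /andP[_ /eqP->] /andP[_ /eqP->].
have QE H P : partition H C -> partition P S' ->
    `[< gd (H :|: P) /\ monochromatic g (H :|: P) >] =
    `[< gd H >] && `[< gd P /\ monochromatic g P >].
  move=> pH pP; have mH := C_mono _ pH.
  case/partitionPP: pH => neH subH _ _; case/partitionPP: pP => neP subP _ _.
  apply/asboolP/andP => [[gG mG]|[/asboolP gH /asboolP[gP mP]]].
    split; apply/asboolP.
      by apply: cross_ok_sub gG; exact: subsetUl.
    split; first by apply: cross_ok_sub gG; exact: subsetUr.
    by move=> V x y VP; apply: mG; rewrite inE VP orbT.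
  have gC V x : V \in H -> x \in V -> g x = g s.
    by move=> VH /(subH _ _ VH); rewrite inE => /andP[_ /eqP].
  have gS' V x : V \in P -> x \in V -> g x != g s.
    by move=> VH /(subP _ _ VH); rewrite S'E => /andP[].
  have inS V x : V \in H :|: P -> x \in V -> x \in S.
    by move=> /setUP[VH|VP] xV; rewrite SE inE ?(subH _ _ VH) // (subP _ _ VP)
      ?orbT.
  have mG : monochromatic g (H :|: P).
    by move=> V x y /setUP[/mH|/mP]; apply.
  split=> // V W x y z w VG WG VW xV yW zV wW xy yz zw.
  (* crossing blocks lie in the same fibre, hence both in C or both in S' *)
  have e := gS _ _ _ _ (inS _ _ VG xV) (inS _ _ WG yW) (inS _ _ VG zV)
    (inS _ _ WG wW) xy yz zw (mG _ _ _ VG xV zV) (mG _ _ _ WG yW wW).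
  case/setUP: (VG) => [VH|VP]; case/setUP: (WG) => [WH|WP].
  - exact: (gH V W x y z w).
  - by have := gS' _ _ WP yW; rewrite -e (gC _ _ VH xV) eqxx.
  - by have := gS' _ _ VP xV; rewrite e (gC _ _ WH yW) eqxx.
  - exact: (gP V W x y z w).
rewrite (bigD1 (g s)) //= -/C moment; last first.
  by move=> x y /(subsetP CS) xS /(subsetP CS) yS; exact: dS.
rewrite big_distrl /= [RHS]big_mkcondr /=; apply: eq_bigr => H pH.
under eq_bigl => P do
  (have -> : partition P S' && `[< gd (H :|: P) /\ monochromatic g (H :|: P) >] =
     `[< gd H >] && (partition P S' && `[< gd P /\ monochromatic g P >])
   by case pP: (partition P S') => /=; rewrite ?andbF // QE).
case: asboolP => gH /=; last by rewrite big_pred0.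
rewrite -big_distrr /=; congr (_ * _).
rewrite IH //; last 2 first.
- by move=> x y /(subsetP S'S) xS /(subsetP S'S); exact: dS.
- move=> v v' w w' /(subsetP S'S) + /(subsetP S'S) + /(subsetP S'S) +
  /(subsetP S'S).
  exact: gS.
rewrite (bigD1 (g s)) //= [X in M X](_ : _ = set0); last first.
  by apply/setP => x; rewrite in_set0 in_set S'E; case: eqP; rewrite ?andbF.
rewrite moment_set0 mul1r; apply: eq_bigr => y ys; congr M.
apply/setP => x; rewrite in_set S'E in_set.
by case: (g x =P y) => [->|]; rewrite ?ys ?andbT ?andbF.
Qed.

End Factor.

Section Color.
Variables (n : nat) (I : eqType) (eps : I -> I -> bool) (d : 'I_n -> I).
Hypothesis heps : symmetric eps.
Variables (K : comPzRingType) (wt M : {set 'I_n} -> K).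
Notation gd := (cross_ok eps (fun x : 'I_n => val x) d).
Hypothesis moment : forall Z : {set 'I_n},
  (forall x y, x \in Z -> y \in Z -> d x = d y) ->
  M Z = \sum_(P | partition P Z && `[< gd P >]) \prod_(V in P) wt V.

(** The colour-respecting eps-noncrossing partitions of a set X of positions,
    described through their crossings. *)
Definition admissible (X : {set 'I_n}) (G : {set {set 'I_n}}) : bool :=
  partition G X && `[< gd G /\ monochromatic d G >].

(** The position of s relative to all blocks of H that a block of colour c must
    not cross. *)
Definition gaps (c : I) (H : {set {set 'I_n}}) (s : 'I_n) :
    {ffun {set 'I_n} -> {set 'I_n}} :=
  [ffun U => if (U \in H) && [exists u in U, ~~ eps c (d u)]
             then gap U s else set0].

(** A partition P of the points of colour c is compatible with the blocks H of
    the other colours exactly when its blocks lie in fibres of gaps c H. *)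
Lemma admissible_setU (X : {set 'I_n}) (c : I) (H P : {set {set 'I_n}}) :
  partition H [set x in X | d x != c] -> partition P [set x in X | d x == c] ->
  `[< gd (H :|: P) /\ monochromatic d (H :|: P) >] =
  `[< gd H /\ monochromatic d H >] && `[< gd P /\ monochromatic (gaps c H) P >].
Proof.
move=> /partitionPP[neH subH _ _] /partitionPP[neP subP _ _].
have dH V x : V \in H -> x \in V -> d x != c.
  by move=> VH /(subH _ _ VH); rewrite inE => /andP[].
have dP V x : V \in P -> x \in V -> d x = c.
  by move=> VH /(subP _ _ VH); rewrite inE => /andP[_ /eqP].
have HP V W : V \in H -> W \in P -> V != W.
  move=> VH WP; apply/eqP => VW; have [x xV] := neH _ VH.
  by have := dH _ _ VH xV; rewrite (dP W) ?eqxx // -VW.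
have nHP U V v : U \in H -> V \in P -> v \in V -> v \notin U.
  by move=> UH VP vV; apply/negP => /(dH _ _ UH); rewrite (dP _ _ VP vV) eqxx.
apply/asboolP/andP => [[gG mG]|[/asboolP[gH mH] /asboolP[gP mP]]].
  have [gH gP] : gd H /\ gd P.
    by split; apply: cross_ok_sub gG; [exact: subsetUl|exact: subsetUr].
  have mH : monochromatic d H by move=> V x y VH; apply: mG; rewrite inE VH.
  split; apply/asboolP; split=> //.
  move=> V v v' VP vV v'V; apply/ffunP => U; rewrite !ffunE.
  case: ifP => // /andP[UH /existsP[u0 /andP[u0U bad]]].
  wlog lt : v v' vV v'V / (v < v')%N.
    move=> wl; case: (ltngtP v v') => [|lt|/val_inj ->//]; first exact: wl.
    by rewrite (wl v' v).
  have nu u : u \in U -> ~~ eps c (d u).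
    by move=> uU; rewrite (mH _ _ _ UH uU u0U).
  have UG : U \in H :|: P by rewrite inE UH.
  have VG : V \in H :|: P by rewrite inE VP orbT.
  apply: gap_eq => //; try exact: nHP VP _.
  move=> u u' uU u'U vu uv' [u'v|v'u'].
    have := gG _ _ _ _ _ _ UG VG (HP _ _ UH VP) u'U vV uU v'V u'v vu uv'.
    by rewrite (dP _ _ VP vV) heps (negbTE (nu _ u'U)).
  have VU : V != U by rewrite eq_sym HP.
  have := gG _ _ _ _ _ _ VG UG VU vV uU v'V u'U vu uv' v'u'.
  by rewrite (dP _ _ VP vV) (negbTE (nu _ uU)).
split; last first.
  move=> V x y /setUP[/mH|VP]; first exact.
  by move=> /(dP _ _ VP) -> /(dP _ _ VP) ->.
move=> V W x y z w /setUP[VH|VP] /setUP[WH|WP] VW xV yW zV wW xy yz zw.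
- exact: (gH V W x y z w).
- apply: contraPT (mP _ _ _ WP yW wW) => bad /ffunP/(_ V); rewrite !ffunE VH /=.
  have -> : [exists u in V, ~~ eps c (d u)].
    by apply/existsP; exists x; rewrite xV heps -(dP _ _ WP yW).
  by apply: gap_neq zV xV _ _ _ => //; left.
- apply: contraPT (mP _ _ _ VP xV zV) => bad /ffunP/(_ W); rewrite !ffunE WH /=.
  have -> : [exists u in W, ~~ eps c (d u)].
    by apply/existsP; exists y; rewrite yW -(dP _ _ VP xV).
  by apply: gap_neq yW wW _ _ _ => //; right.
- exact: (gP V W x y z w).
Qed.

Lemma sum_color (X : {set 'I_n}) (c : I) :
  \sum_(G | admissible X G) \prod_(V in G) wt V =
  \sum_(H | admissible [set x in X | d x != c] H) (\prod_(V in H) wt V) *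
    \prod_y M [set x in X | (d x == c) && (gaps c H x == y)].
Proof.
set R := [set x in X | d x != c]; set S := [set x in X | d x == c].
have XE : X = R :|: S.
  by apply/setP => x; rewrite !inE; case: (x \in X); case: eqP.
have dRS : [disjoint R & S].
  by apply/pred0P => x; rewrite /= !inE; case: (x \in X); case: eqP.
rewrite /admissible {1}XE sum_partition_split //; last first.
  move=> G /partitionPP[ne sub _ _] /asboolP[_ mG] V VG.
  have [x xV] := ne _ VG; have := sub _ _ VG xV; rewrite -XE => xX.
  have VX y : y \in V -> y \in X by move=> yV; rewrite XE; exact: sub yV.
  case dx: (d x == c); [right|left]; apply/subsetP => y yV;
  by rewrite inE VX //= (mG _ _ _ VG yV xV) dx.
rewrite [RHS]big_mkcondr /=; apply: eq_bigr => H pH.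
under eq_bigl => P do
  (have -> : partition P S && `[< gd (H :|: P) /\ monochromatic d (H :|: P) >] =
     `[< gd H /\ monochromatic d H >] &&
       (partition P S && `[< gd P /\ monochromatic (gaps c H) P >])
   by case pP: (partition P S) => /=; rewrite ?andbF // (admissible_setU pH pP)).
case: asboolP => gH /=; last by rewrite big_pred0.
rewrite -big_distrr /=; congr (_ * _).
rewrite (moment_factor moment) //.
- apply: eq_bigr => y _; congr M; apply/setP => x.
  by rewrite !inE andbA.
- by move=> x y; rewrite !inE => /andP[_ /eqP ->] /andP[_ /eqP ->].
- move=> v v' w w' vS v'S wS w'S vv' v'w ww' /ffunP e1 /ffunP e2.
  apply/ffunP => U; move: (e1 U) (e2 U); rewrite !ffunE; case: ifP => // _.
  exact: gap_nocross.
Qed.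

End Color.

(** * Ordered products with modified letters *)

Section OrderedProducts.
Variables (R : pzSemiRingType) (n : nat).
Implicit Types (P : pred 'I_n) (F a : 'I_n -> R).

Lemma prod_split P (k : 'I_n) F : P k ->
  \prod_(j | P j) F j =
  (\prod_(j | P j && (j < k)%N) F j) * F k * \prod_(j | P j && (k < j)%N) F j.
Proof.
move=> Pk.
have srt : pairwise (fun i j : 'I_n => (i < j)%N) (index_enum 'I_n).
  have : pairwise ltn (map val (index_enum 'I_n)).
    rewrite -[index_enum _]enumT val_enum_ord.
    by rewrite -(sorted_pairwise ltn_trans) iota_ltn_sorted.
  by rewrite pairwise_map.
have kE : k \in index_enum 'I_n by rewrite mem_index_enum.
case/splitPr: kE srt => s1 s2.
rewrite pairwise_cat pairwise_cons allrel_consr =>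
  /and3P[/andP[/allP s1k _] _ /andP[/allP ks2 _]].
rewrite !big_cat !big_cons /= Pk ltnn andbF.
rewrite [X in _ = _ * X * _ * _]big_hasC; last first.
  by apply/hasPn => j /ks2 kj; rewrite negb_and -leqNgt ltnW ?orbT.
rewrite [X in _ = _ * (X * _)]big_hasC; last first.
  by apply/hasPn => j /s1k jk; rewrite negb_and -leqNgt ltnW ?orbT.
rewrite mulr1 mul1r -mulrA; congr (_ * (_ * _)).
  rewrite big_seq_cond [RHS]big_seq_cond; apply: eq_bigl => j.
  by case js: (j \in s1) => //=; rewrite s1k ?andbT.
rewrite big_seq_cond [RHS]big_seq_cond; apply: eq_bigl => j.
by case js: (j \in s2) => //=; rewrite ks2 ?andbT.
Qed.

(** The family f with its k-th entry replaced by x. *)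
Definition upd T (f : 'I_n -> T) (k : 'I_n) (x : T) : 'I_n -> T :=
  fun j => if j == k then x else f j.

Lemma updE T (f : 'I_n -> T) k x : upd f k x k = x.
Proof. by rewrite /upd eqxx. Qed.

Lemma upd_neq T (f : 'I_n -> T) k x j : j != k -> upd f k x j = f j.
Proof. by rewrite /upd => /negbTE ->. Qed.

(** The word a with the letter at l multiplied into the letter at k and
    replaced by 1. *)
Definition merge_at a k l : 'I_n -> R := upd (upd a k (a k * a l)) l 1.

Lemma prod_merge (Z : {set 'I_n}) a (k l : 'I_n) :
  k \in Z -> l \in Z -> (k < l)%N ->
  (forall p : 'I_n, p \in Z -> (k < p)%N -> (p < l)%N -> a p * a l = a l * a p) ->
  \prod_(j in Z) merge_at a k l j = \prod_(j in Z) a j.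
Proof.
move=> kZ lZ kl comm.
have ml j : j != k -> j != l -> merge_at a k l j = a j.
  by move=> jk jl; rewrite /merge_at !upd_neq.
rewrite (prod_split _ kZ) [RHS](prod_split _ kZ).
rewrite ![\prod_(j | (j \in Z) && (k < j)%N) _](@prod_split _ l) ?lZ //.
have -> : merge_at a k l l = 1 by rewrite /merge_at updE.
have -> : merge_at a k l k = a k * a l.
  by rewrite /merge_at upd_neq ?updE // neq_ltn kl.
rewrite -!mulrA; congr (_ * _).
  by apply: eq_bigr => j /andP[_ jk]; rewrite ml // neq_ltn ?jk //
    (ltn_trans jk kl).
congr (_ * _); rewrite mul1r !mulrA; congr (_ * _); last first.
  apply: eq_bigr => j /andP[/andP[_ kj] lj].
  by rewrite ml // neq_ltn ?kj ?lj ?orbT.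
rewrite [LHS](_ : _ = a l * \prod_(j | (j \in Z) && (k < j)%N && (j < l)%N) a j).
  elim/big_ind: _ => [|x y cx cy|j /andP[/andP[jZ kj] jl]].
  - by rewrite mulr1 mul1r.
  - by rewrite mulrA cx -mulrA cy mulrA.
  - by rewrite comm.
congr (_ * _); apply: eq_bigr => j /andP[/andP[_ kj] jl].
by rewrite ml // neq_ltn ?kj ?jl ?orbT.
Qed.

Lemma prod_unit (Z : {set 'I_n}) a l : a l = 1 ->
  \prod_(j in Z :\ l) a j = \prod_(j in Z) a j.
Proof.
move=> al; rewrite big_mkcond [RHS]big_mkcond; apply: eq_bigr => j _.
by rewrite !inE; case: eqP => [->|] //=; rewrite al if_same.
Qed.

End OrderedProducts.

(** * Moments and cumulant sums on subsets of the positions *)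

Section Invariance.
Variables (K : fieldType) (A : algType K) (phi : {scalar A}).
Variables (I : eqType) (eps : I -> I -> bool).
Hypothesis heps : symmetric eps.
Variables (n : nat) (d : 'I_n -> I).
Implicit Types (a : 'I_n -> A) (X Z V : {set 'I_n}).

(** The factor that the block V contributes, for the decoration d. *)
Definition block_cumulant a V : K := eps_cumulant phi eps (restr (X := V) d)
  (restr (X := V) a).
(** The moment of the subword of a at the positions in X. *)
Definition moment a X : K := phi (\prod_(j in X) a j).
(** The sum over the admissible partitions of X that is to be identified with
    the moment of the subword at X. *)
Definition cumulant_sum a X : K := \sum_(G | admissible eps d X G)
  \prod_(V in G) block_cumulant a V.

Hypothesis momentE : forall a Z,
  (forall x y, x \in Z -> y \in Z -> d x = d y) ->
  moment a Z =
  \sum_(P | partition P Z && `[< cross_ok eps (fun x : 'I_n => val x) d P >])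
    \prod_(V in P) block_cumulant a V.

Let sumE a X c := sum_color heps (momentE a) X c.

Lemma eq_block_cumulant a a' V : {in V, a =1 a'} -> block_cumulant a V =
  block_cumulant a' V.
Proof.
move=> e; rewrite /block_cumulant; congr eps_cumulant; apply: funext => j.
by rewrite /restr e // enum_valP.
Qed.

Lemma eq_moment a a' X : {in X, a =1 a'} -> moment a X = moment a' X.
Proof. by move=> e; congr (phi _); exact: eq_bigr. Qed.

Lemma eq_block_cumulant_off a a' X c H :
  {in X, forall x, d x != c -> a x = a' x} ->
  admissible eps d [set x in X | d x != c] H ->
  \prod_(V in H) block_cumulant a V = \prod_(V in H) block_cumulant a' V.
Proof.
move=> e /andP[/partitionPP[_ sub _ _] _]; apply: eq_bigr => V VH.
by apply: eq_block_cumulant => x /(sub _ _ VH); rewrite inE => /andP[xX dx];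
  exact: e.
Qed.

Lemma cumulant_sum_unit a X l : a l = 1 -> l \in X -> cumulant_sum a (X :\ l) =
  cumulant_sum a X.
Proof.
move=> al lX; rewrite /cumulant_sum (sumE a X (d l)) (sumE a (X :\ l) (d l)).
have -> : [set x in X :\ l | d x != d l] = [set x in X | d x != d l].
  by apply/setP => x; rewrite !inE; case: (x =P l) => [->|] //=;
    rewrite eqxx !andbF.
apply: eq_bigr => H _; congr (_ * _); apply: eq_bigr => y _.
rewrite /moment -[in RHS](prod_unit _ al); congr (phi _); apply: eq_bigl => x.
by rewrite !inE -?andbA.
Qed.

(** Letters of the same colour may be merged when the letters between them have
    other colours, all eps-related to theirs. *)
Lemma cumulant_sum_merge a X (k l : 'I_n) : k \in X -> l \in X -> (k < l)%N ->
  d k = d l ->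
  (forall p : 'I_n, p \in X -> (k < p)%N -> (p < l)%N ->
     d p != d k /\ eps (d p) (d k)) ->
  cumulant_sum (merge_at a k l) X = cumulant_sum a X.
Proof.
move=> kX lX kl dkl btw; rewrite /cumulant_sum (sumE (merge_at a k l) X (d l))
  (sumE a X (d l)).
have am j : d j != d l -> merge_at a k l j = a j.
  move=> dj; rewrite /merge_at !upd_neq //; apply: contraNneq dj => -> //.
  by rewrite dkl.
apply: eq_bigr => H aH; congr (_ * _).
  by apply: eq_block_cumulant_off aH => x _; exact: am.
apply: eq_bigr => y _; set Z := [set x in X | _].
(* a block of H having a point between k and l is one that colour c may cross *)
have gapkl : gaps eps d (d l) H k = gaps eps d (d l) H l.
  apply/ffunP => U; rewrite !ffunE;
    case: ifP => // /andP[UH /existsP[u0 /andP[u0U bad]]].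
  case/andP: aH => /partitionPP[_ sub _ _] /asboolP[_ mH].
  have nU s : d s = d l -> s \notin U.
    by move=> ds; apply/negP => /(sub _ _ UH); rewrite inE ds eqxx andbF.
  apply: gap_eq; rewrite ?nU // => u u' uU _ ku ul _.
  have := sub _ _ UH uU; rewrite inE => /andP[uX _].
  case: (btw u uX ku ul) => _; rewrite dkl heps => e.
  by rewrite (mH _ _ _ UH u0U uU) e in bad.
have kZl : (k \in Z) = (l \in Z) by rewrite !inE kX lX dkl gapkl.
(* Z contains both k and l, and then they are neighbours in it, or neither *)
have [kZ|kZ] := boolP (k \in Z); last first.
  apply: eq_moment => j jZ; rewrite /merge_at !upd_neq //.
    by apply: contraNneq kZ => <-.
  by apply: contraNneq kZ => jl; rewrite kZl -jl.
congr (phi _); apply: prod_merge => //; first by rewrite -kZl.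
move=> p; rewrite inE => /and3P[pX /eqP dp _] kp pl.
by case: (btw p pX kp pl); rewrite dp dkl eqxx.
Qed.

Lemma moment_lin a X k (u v : A) (t : K) : k \in X ->
  moment (upd a k (t *: u + v)) X =
  t * moment (upd a k u) X + moment (upd a k v) X.
Proof.
move=> kX; rewrite /moment.
have E x : \prod_(j in X) upd a k x j =
   (\prod_(j in X | (j < k)%N) a j) * x * \prod_(j in X | (k < j)%N) a j.
  rewrite (prod_split _ kX) updE; congr (_ * _ * _); apply:
    eq_bigr => j /andP[_ jk];
  by rewrite upd_neq // neq_ltn jk ?orbT.
by rewrite !E mulrDr mulrDl -scalerAr -scalerAl linearP.
Qed.

Lemma cumulant_sum_lin a X k (u v : A) (t : K) : k \in X ->
  cumulant_sum (upd a k (t *: u + v)) X =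
  t * cumulant_sum (upd a k u) X + cumulant_sum (upd a k v) X.
Proof.
move=> kX; rewrite /cumulant_sum (sumE (upd a k (t *: u + v)) X (d k)).
rewrite (sumE (upd a k u) X (d k)) (sumE (upd a k v) X (d k)).
rewrite big_distrr -big_split /=.
apply: eq_bigr => H aH.
have wE x : \prod_(V in H) block_cumulant (upd a k x) V =
  \prod_(V in H) block_cumulant a V.
  apply: eq_block_cumulant_off aH => j _ dj; rewrite upd_neq //.
  by apply: contraNneq dj => ->.
rewrite !wE [t * _]mulrCA -mulrDr; congr (_ * _).
pose y0 := gaps eps d (d k) H k.
pose Z y := [set x in X | (d x == d k) && (gaps eps d (d k) H x == y)].
have mE x : \prod_y moment (upd a k x) (Z y) =
    moment (upd a k x) (Z y0) * \prod_(y | y != y0) moment a (Z y).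
  rewrite (bigD1 y0) //=; congr (_ * _); apply: eq_bigr => y yy.
  apply: eq_moment => j; rewrite inE => /and3P[_ _ /eqP jy].
  by rewrite upd_neq //; apply: contraNneq yy => jk; rewrite -jy jk.
rewrite !mE moment_lin ?inE ?kX ?eqxx //.
by rewrite mulrDl -mulrA.
Qed.

Lemma cumulant_sum_set0 a : cumulant_sum a set0 = 1.
Proof.
rewrite /cumulant_sum (big_pred1 set0) ?big_set0 // => P;
  rewrite /admissible partition_set0.
apply: andb_idr => /eqP ->; apply/asboolP.
by split=> [V W ? ? ? ?|V ? ?]; rewrite inE.
Qed.

End Invariance.

(** * Increasing enumeration of subsets *)

Section Enumeration.

Lemma sorted_enum n (X : {set 'I_n}) : sorted ltn (map val (enum X)).
Proof.
rewrite sorted_map /enum_mem sorted_filter //=.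
  by move=> x y z /=; exact: ltn_trans.
by have := iota_ltn_sorted 0 n; rewrite -val_enum_ord sorted_map enumT.
Qed.

Lemma ltn_enum_val n (X : {set 'I_n}) :
  {mono (@enum_val _ (mem X)) : i j / (i < j)%N}.
Proof.
have homo (k l : 'I_#|X|) : (k < l)%N -> (enum_val k < enum_val l)%N.
  have x0 := enum_val k; have sz := cardE X.
  rewrite !(enum_val_nth x0) -!(nth_map x0 0%N val) -?sz ?ltn_ord // => kl.
  by apply: (sorted_ltn_nth ltn_trans) => //; rewrite ?sorted_enum // inE
    size_map -sz ltn_ord.
move=> i j.
case: (ltngtP i j) => [/homo->//|/homo/ltnW|/val_inj->]; last by rewrite ltnn.
by rewrite ltnNge => ->.
Qed.

Lemma enum_imset_incr m n (f : 'I_m -> 'I_n) (X : {set 'I_m}) :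
  {mono f : i j / (i < j)%N} -> enum (f @: X) = map f (enum X).
Proof.
move=> fm; apply: (inj_map val_inj).
apply: (irr_sorted_eq ltn_trans ltnn); first exact: sorted_enum.
  rewrite -map_comp sorted_map; have := sorted_enum X; rewrite sorted_map.
  by apply: sub_sorted => i j /=; rewrite fm.
apply: eq_mem_map => x; rewrite mem_enum.
apply/imsetP/mapP => -[y yX ->]; exists y => //; first by rewrite mem_enum.
by rewrite mem_enum in yX.
Qed.

Lemma incr_inj m n (f : 'I_m -> 'I_n) :
  {mono f : i j / (i < j)%N} -> injective f.
Proof.
move=> fm i j fij; apply: val_inj; case: (ltngtP i j) => // /=;
  rewrite -fm fij ltnn //.
Qed.

(** Restricting to the image of W under an increasing map f is restricting to W
    after composition with f, up to the equality of the two cardinals; hence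
    any function Q of a pair of families takes the same value on both. *)
Lemma restr_imset_incr m n (f : 'I_m -> 'I_n) (W : {set 'I_m}) (T1 T2 U : Type)
    (Q : forall k, ('I_k -> T1) -> ('I_k -> T2) -> U)
    (g1 : 'I_n -> T1) (g2 : 'I_n -> T2) :
  {mono f : i j / (i < j)%N} ->
  Q _ (restr (X := f @: W) g1) (restr (X := f @: W) g2) =
  Q _ (restr (X := W) (g1 \o f)) (restr (X := W) (g2 \o f)).
Proof.
move=> fm; have e : #|f @: W| = #|W| by rewrite card_imset //; exact: incr_inj.
have E T (g : 'I_n -> T) :
    restr (X := f @: W) g = fun j => restr (X := W) (g \o f) (cast_ord e j).
  apply: funext => j; rewrite /restr /=; congr g.
  have x0 := enum_val (cast_ord e j).
  rewrite (enum_val_nth x0) (enum_val_nth (f x0)) enum_imset_incr //.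
  by rewrite (nth_map x0) // -cardE -e ltn_ord.
rewrite !E {E}; move: e; move: #|f @: W| => k e; subst k.
by congr Q; apply: funext => j; rewrite cast_ord_id.
Qed.

Lemma enum_val_imsetT n (X : {set 'I_n}) :
  [set enum_val i | i in [set: 'I_#|X|]] = X.
Proof.
apply/setP => x; apply/imsetP/idP => [[i _ ->]|xX]; first exact: enum_valP.
by exists (enum_rank_in xX x); rewrite ?inE // enum_rankK_in.
Qed.

Lemma prod_enum_val n (R : pzSemiRingType) (X : {set 'I_n}) (a : 'I_n -> R) :
  \prod_(j in X) a j = \prod_(j < #|X|) a (enum_val j).
Proof.
have enumE m (Y : {set 'I_m}) (F : 'I_m -> R) :
    \prod_(j in Y) F j = \prod_(j <- enum Y) F j.
  by rewrite /enum_mem big_filter.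
rewrite enumE -{1}[X]enum_val_imsetT enum_imset_incr; last exact: ltn_enum_val.
by rewrite big_map -enumE; apply: eq_bigl => j; rewrite inE.
Qed.

End Enumeration.

(** * Moments as cumulant sums, by induction on the word *)

Section Induction.
Variables (K : fieldType) (A : algType K) (phi : {scalar A}).
Hypothesis hphi : phi 1 = 1.
Variables (I : eqType) (eps : I -> I -> bool).
Hypothesis heps : symmetric eps.
Variables (n : nat) (d : 'I_n -> I).
Implicit Types (a : 'I_n -> A) (X Z V : {set 'I_n}).
Notation block_cumulant := (block_cumulant phi eps d).
Notation moment := (moment phi).
Notation cumulant_sum := (cumulant_sum phi eps d).

Hypothesis momentE : forall a Z,
  (forall x y, x \in Z -> y \in Z -> d x = d y) ->
  moment a Z =
  \sum_(P | partition P Z && `[< cross_ok eps (fun x : 'I_n => val x) d P >])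
    \prod_(V in P) block_cumulant a V.

Lemma block_cumulant_set1 a k : block_cumulant a [set k] = phi (a k).
Proof.
transitivity (moment a [set k]); last by rewrite /moment big_set1.
rewrite momentE => [|x y /set1P -> /set1P -> //].
rewrite (big_pred1 [set [set k]]) ?big_set1 // => P.
apply/andP/eqP => [[/partitionPP[ne sub cov inj] _]|->].
  have /cov[V VP kV] := set11 k.
  have VE W : W \in P -> W = [set k].
    move=> WP; apply/eqP; rewrite eqEsubset; apply/andP; split.
      by apply/subsetP => x /(sub _ _ WP).
    have [x xW] := ne _ WP.
    by move/set1P: (sub _ _ WP xW) => <-; rewrite sub1set.
  by apply/setP => W; rewrite !inE; apply/idP/eqP => [/VE//|->]; rewrite -(VE V).
split; last by apply/asboolP => V W ? ? ? ? /set1P -> /set1P ->; rewrite eqxx.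
apply/partitionPP; split.
- by move=> V /set1P ->; exists k; rewrite inE.
- by move=> V x /set1P ->.
- by move=> x xk; exists [set k]; rewrite // inE.
- by move=> V W x /set1P -> /set1P ->.
Qed.

(** The word of colours on X is eps-reduced: between two occurrences of a colour
    some letter of another colour is not eps-related to it. *)
Definition reduced X : Prop :=
  forall k l : 'I_n, k \in X -> l \in X -> (k < l)%N -> d k = d l ->
  exists p : 'I_n, [/\ p \in X, (k < p)%N, (p < l)%N, d p != d k
                     & ~~ eps (d p) (d k)].

(** If there is no singleton block, take two points k < l of a block at minimal
    distance.  A letter p between them and not eps-related to them lies in a
    block that has another point: either again between k and l, hence closer to
    p than k is to l, or outside, which makes a forbidden crossing. *)
Lemma admissible_singleton X G : reduced X -> X != set0 -> admissible eps d X G ->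
  exists k, [set k] \in G.
Proof.
move=> red /set0Pn[x0 x0X] /andP[/partitionPP[ne sub cov inj] /asboolP[gG mG]].
apply: contrapT => nosing.
have other U p : U \in G -> p \in U -> exists2 q, q \in U & q != p.
  move=> UG pU; apply: contrapT => noq; apply: nosing; exists p.
  rewrite (_ : [set p] = U) //; apply/setP => q; rewrite inE.
  apply/eqP/idP => [->//|qU]; apply/eqP/negPn/negP => qp.
  by apply: noq; exists q.
have pairF m V (k l : 'I_n) : (l - k < m)%N -> V \in G -> k \in V -> l \in V ->
    (k < l)%N -> False.
  elim: m V k l => // m IH V k l; rewrite ltnS => lkm VG kV lV kl.
  have [p [pX kp pl dp ep]] :=
    red _ _ (sub _ _ VG kV) (sub _ _ VG lV) kl (mG _ _ _ VG kV lV).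
  have [U UG pU] := cov _ pX.
  have UV : U != V by apply: contraNneq dp => UV; rewrite (mG U p k) // UV.
  have [q qU qp] := other _ _ UG pU.
  have neq r : r \in V -> q != r.
    by move=> rV; apply: contraNneq UV => qr; rewrite (inj U V r) // -qr.
  case: (ltngtP q k) => [qk|kq|/val_inj /eqP];
    last by rewrite (negbTE (neq _ kV)).
    have := gG _ _ _ _ _ _ UG VG UV qU kV pU lV qk kp pl.
    by rewrite (mG _ _ _ UG qU pU) (negbTE ep).
  case: (ltngtP q l) => [ql|lq|/val_inj /eqP];
    last by rewrite (negbTE (neq _ lV)).
    case: (ltngtP q p) => [qp'|pq|/val_inj /eqP]; last by rewrite (negbTE qp).
      apply: (IH U q p) => //; apply: leq_trans lkm.
      by rewrite (leq_ltn_trans (leq_sub2l _ (ltnW kq))) // ltn_sub2r.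
    apply: (IH U p q) => //; apply: leq_trans lkm.
    by rewrite (leq_ltn_trans (leq_sub2l _ (ltnW kp))) // ltn_sub2r.
  have VU : V != U by rewrite eq_sym.
  have := gG _ _ _ _ _ _ VG UG VU kV pU lV qU kp pl lq.
  by rewrite heps (negbTE ep).
have [V VG xV] := cov _ x0X; have [y yV] := other _ _ VG xV.
rewrite neq_ltn => /orP[] lt; first exact: (pairF _ V _ _ (ltnSn _) VG yV xV lt).
exact: (pairF _ V _ _ (ltnSn _) VG xV yV lt).
Qed.

Lemma cumulant_sum_centred a X : reduced X -> X != set0 ->
  (forall k, k \in X -> phi (a k) = 0) -> cumulant_sum a X = 0.
Proof.
move=> red X0 cent; rewrite /cumulant_sum big1 // => G aG.
have [k kG] := admissible_singleton red X0 aG; rewrite (bigD1 [set k]) //=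
  block_cumulant_set1.
case/andP: aG => /partitionPP[_ sub _ _] _.
by rewrite cent ?mul0r //; apply: sub kG _; rewrite inE.
Qed.

(** Two occurrences of a colour that violate reducedness, chosen at minimal
    distance, enclose only letters of other colours, all eps-related to it. *)
Lemma not_reduced X : ~ reduced X ->
  exists k l : 'I_n, [/\ k \in X, l \in X, (k < l)%N, d k = d l &
    forall p : 'I_n, p \in X -> (k < p)%N -> (p < l)%N ->
      d p != d k /\ eps (d p) (d k)].
Proof.
move=> nred; apply: contrapT => none; apply: nred => k l kX lX.
have [m] := ubnP (l - k); elim: m l lX => // m IH l lX;
  rewrite ltnS => lkm kl dkl.
apply: contrapT => nop; apply: none; exists k, l; split=> // p pX kp pl.
have [dp|dp] := eqVneq (d p) (d k).
  case: (IH p pX _ kp (esym dp)).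
    by apply: leq_trans lkm; rewrite ltn_sub2r.
  move=> q [qX kq qp dq eq]; case: nop; exists q; split=> //.
  exact: ltn_trans pl.
split=> //; apply/negPn/negP => ep; apply: nop; exists p.
by split.
Qed.

Variable B : I -> {pred A}.
Hypothesis hB : forall i, GRing.subalg_closed (B i).
Hypothesis hind : eps_independent phi eps B.

Lemma moment_centred a X : reduced X -> X != set0 ->
  (forall k, k \in X -> a k \in B (d k)) ->
  (forall k, k \in X -> phi (a k) = 0) -> moment a X = 0.
Proof.
move=> red X0 aB cent; rewrite /moment prod_enum_val.
apply: (hind.2 _ (restr (X := X) d) (restr (X := X) a)).
- by rewrite card_gt0.
- move=> k l kl dkl.
  have [|p [pX kp pl dp ep]] := red _ _ (enum_valP k) (enum_valP l) _ dkl.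
    by rewrite ltn_enum_val.
  exists (enum_rank_in pX p); rewrite /restr enum_rankK_in //; split=> //.
  by rewrite -!ltn_enum_val enum_rankK_in // kp.
- by move=> k; apply: aB; exact: enum_valP.
- by move=> k; apply: cent; exact: enum_valP.
Qed.

Lemma moment_cumulant_sum a X : (forall k, k \in X -> a k \in B (d k)) ->
  moment a X = cumulant_sum a X.
Proof.
have [m] := ubnP #|X|; elim: m X a => // m IH X a; rewrite ltnS => Xm aB.
have [->|X0] := eqVneq X set0.
  by rewrite cumulant_sum_set0 /moment big_set0.
have B1 i : 1 \in B i by case: (hB i).
have BM i x y : x \in B i -> y \in B i -> x * y \in B i.
  by move=> *; case: (hB i) => _ _; apply.
have IHu a' l : a' l = 1 -> l \in X -> (forall k, k \in X -> a' k \in B (d k)) ->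
    moment a' X = cumulant_sum a' X.
  move=> a'l lX a'B; rewrite -(cumulant_sum_unit heps momentE a'l lX).
  rewrite /moment -(prod_unit _ a'l); apply: IH.
    apply: leq_trans Xm; apply: proper_card; exact: properD1.
  by move=> k /setD1P[_]; exact: a'B.
have [red|] := EM (reduced X); last first.
  move=> /not_reduced[k [l [kX lX kl dkl btw]]].
  rewrite -(cumulant_sum_merge heps momentE a kX lX kl dkl btw).
  have mB j : j \in X -> merge_at a k l j \in B (d j).
    move=> jX; rewrite /merge_at /upd; case: eqP => [_|_]; first exact: B1.
    by case: eqP => [->|_]; [apply: BM; rewrite ?aB // dkl aB|exact: aB].
  have ml : merge_at a k l l = 1 by rewrite /merge_at updE.
  rewrite -(IHu _ l ml lX mB).
  congr (phi _); rewrite prod_merge // => p pX kp pl.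
  have [dp ep] := btw _ pX kp pl.
  apply: (hind.1 (d p) (d l)); rewrite -?dkl ?aB //.
  by rewrite dkl aB.
have [q] := ubnP #|[set j in X | phi (a j) != 0]|.
elim: q a aB => // q IHq a aB; rewrite ltnS => aq.
have [E|[k]] := set_0Vmem [set j in X | phi (a j) != 0].
  have cent k : k \in X -> phi (a k) = 0.
    by move=> kX; move/setP/(_ k): E; rewrite !inE kX => /negbFE/eqP.
  by rewrite moment_centred // cumulant_sum_centred.
rewrite inE => /andP[kX ak].
(* centre the letter at k *)
have aE : a = upd a k (phi (a k) *: 1 + (a k - phi (a k) *: 1)).
  by apply: funext => j; rewrite /upd; case: eqP => // ->; rewrite addrC subrK.
have cB : a k - phi (a k) *: 1 \in B (d k).
  case: (hB (d k)) => _ lin _; rewrite addrC -scaleNr; apply: lin => //.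
  exact: aB.
rewrite aE moment_lin // (cumulant_sum_lin heps momentE) //; congr (_ * _ + _).
  apply: (IHu _ k) => //; first by rewrite updE.
  by move=> j jX; rewrite /upd; case: eqP => // _; exact: aB.
apply: IHq.
  by move=> j jX; rewrite /upd; case: eqP => [->//|_]; exact: aB.
apply: leq_trans aq; apply: proper_card; rewrite properE; apply/andP; split.
  apply/subsetP => j; rewrite !inE /upd; case: (j =P k) => [->|//].
  by rewrite kX ak.
apply/subsetPn; exists k; rewrite inE kX // updE.
by rewrite linearB linearZ /= hphi mulr1 subrr eqxx.
Qed.

End Induction.

(** * Eps-noncrossing partitions and crossings *)

Section CrossingTransfer.
Variables (I : eqType) (eps : I -> I -> bool).
Hypothesis heps : symmetric eps.

(** Passing from the placement pos' to pos only reverses the order of pairs of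
    points with eps-related colours, so it creates no forbidden crossing. *)
Lemma cross_ok_reorder (T : finType) (pos pos' : T -> nat) (d : T -> I)
    (G : {set {set T}}) :
  (forall x y, (pos x < pos y)%N -> (pos' x < pos' y)%N \/ eps (d x) (d y)) ->
  monochromatic d G -> cross_ok eps pos' d G -> cross_ok eps pos d G.
Proof.
move=> ord mG gG V W x y z w VG WG VW xV yW zV wW xy yz zw.
have [xy'|//] := ord _ _ xy.
have [yz'|] := ord _ _ yz; last by rewrite heps (mG _ _ _ VG zV xV).
have [zw'|] := ord _ _ zw; first exact: (gG V W x y z w).
by rewrite (mG _ _ _ VG zV xV) (mG _ _ _ WG wW yW).
Qed.

Variables (T T' : finType) (h : T' -> T) (pos : T -> nat) (pos' : T' -> nat).
Variables (d : T -> I) (d' : T' -> I).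
Hypothesis pos_h : forall x y, (pos' x < pos' y)%N = (pos (h x) < pos (h y))%N.
Hypothesis d_h : forall x, d' x = d (h x).
Variables (G : {set {set T}}) (G' : {set {set T'}}).

Lemma cross_ok_pull :
  (forall V', V' \in G' -> exists2 V, V \in G & forall x, (x \in V') =
    (h x \in V)) ->
  cross_ok eps pos d G -> cross_ok eps pos' d' G'.
Proof.
move=> bl gG V' W' x y z w /bl[V VG VE] /bl[W WG WE] VW.
rewrite !VE !WE !pos_h !d_h; apply: gG => //.
by apply: contraNneq VW => VW; apply/eqP/setP => t; rewrite VE WE VW.
Qed.

Lemma cross_ok_push :
  (forall V, V \in G -> exists V', [/\ V' \in G',
     forall x, (x \in V') = (h x \in V) & forall x, x \in V -> exists x', x =
       h x']) ->
  cross_ok eps pos' d' G' -> cross_ok eps pos d G.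
Proof.
move=> bl gG V W x y z w /bl[V' [VG VE Vs]] /bl[W' [WG WE Ws]] VW.
move=> /[dup] /Vs[{}x ->] + /[dup] /Ws[{}y ->] + /[dup] /Vs[{}z ->] + /[dup]
  /Ws[{}w ->].
rewrite -!VE -!WE -!pos_h -!d_h; apply: gG => //.
apply: contraNneq VW => VW'; apply/eqP/setP => t; apply/idP/idP => tV.
  by have [t' tE] := Vs _ tV; move: tV; rewrite tE -VE -WE VW'.
by have [t' tE] := Ws _ tV; move: tV; rewrite tE -VE -WE VW'.
Qed.

End CrossingTransfer.

Section EpsNoncrossingCrossings.
Variables (I : eqType) (eps : I -> I -> bool).
Hypothesis heps : symmetric eps.

Section Perm.
Variables (n : nat) (d : 'I_n -> I) (G : {set {set 'I_n}}).
Hypothesis mG : monochromatic d G.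

(** Exchanging two consecutive integers reverses no other pair. *)
Lemma tperm_succ_lt (i i' x y : 'I_n) : i' = i.+1 :> nat -> (x < y)%N ->
  (tperm i i' x < tperm i i' y)%N \/ x = i /\ y = i'.
Proof.
have V (u w : 'I_n) : u <> w -> u <> w :> nat by move=> uw /val_inj.
move=> ii'; case: tpermP => [->|->|/V xi /V xi'];
  case: tpermP => [->|->|/V yi /V yi'] xy; try (left; lia).
by right.
Qed.

Lemma allowed_perm_cross_ok s : allowed_perm eps d G s ->
  cross_ok eps (fun x : 'I_n => val x) d G <-> cross_ok eps (fun x => val (s x))
    d G.
Proof.
elim=> [|{}s i i' _ IH [ii' e _]].
  by split; apply: (cross_ok_reorder heps _ mG) => x y; rewrite !perm1; left.
rewrite IH {IH}; rewrite /perm_deco in e.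
split; apply: (cross_ok_reorder heps _ mG) => x y; rewrite !permM.
  move=> /(tperm_succ_lt ii'); rewrite !tpermK => -[|[xi yi]]; first by left.
  right; rewrite -[x](permK s) -[y](permK s) -[s x](tpermK i i')
    -[s y](tpermK i i').
  by rewrite xi yi tpermL tpermR heps.
move=> /(tperm_succ_lt ii')[|[xi yi]]; first by left.
by right; rewrite -[x](permK s) -[y](permK s) xi yi.
Qed.

(** A nonempty set that is not an interval has a point i followed by a point not
    in the set and, further on, by another point k of the set. *)
Lemma interval_or_gap (W : {set 'I_n}) : W != set0 -> is_interval W \/
  exists i i' k : 'I_n, [/\ i' = i.+1 :> nat, i \in W, i' \notin W, k \in W &
    (i' < k)%N].
Proof.
case/set0Pn => w0 w0W; have [gapW|nogap] := EM (exists i i' k : 'I_n,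
  [/\ i' = i.+1 :> nat, i \in W, i' \notin W, k \in W & (i' < k)%N]);
    [by right|left].
case: (arg_minnP (fun i : 'I_n => val i) w0W) => m mW mmin.
case: (arg_maxnP (fun i : 'I_n => val i) w0W) => M MW Mmax.
exists m, M.+1; apply/setP => j; rewrite inE ltnS.
apply/idP/andP => [jW|[]]; first by rewrite mmin //; split=> //; exact: Mmax.
case: j => j jn /=; elim: j jn => [|j IH] jn mj jM.
  by rewrite (_ : Ordinal jn = m) //; apply: val_inj => /=; apply/esym/eqP;
    rewrite -leqn0.
move: mj; rewrite leq_eqVlt => /orP[/eqP mj|mj].
  by rewrite (_ : Ordinal jn = m) //; apply: val_inj.
have jn' : (j < n)%N by exact: ltnW.
have jW := IH jn' mj (ltnW jM).
apply/negPn/negP => jN; apply: nogap; exists (Ordinal jn'), (Ordinal jn), M;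
  split=> //.
rewrite /= ltn_neqAle jM andbT; apply: contraNneq jN => jM'.
by rewrite (_ : Ordinal jn = M) //; apply: val_inj.
Qed.

Hypothesis pG : partition G [set: 'I_n].

Lemma partition_perm s : partition (perm_part s G) [set: 'I_n].
Proof.
case/partitionPP: pG => ne sub cov inj; apply/partitionPP; split.
- by move=> _ /imsetP[V VG ->]; have [x xV] := ne _ VG; exists (s x); exact:
  imset_f.
- by [].
- move=> x _; have [|V VG xV] := cov (s^-1 x)%g; first by rewrite inE.
  by exists (s @: V); [exact: imset_f|rewrite -[x](permKV s) imset_f].
- move=> _ _ x /imsetP[V VG ->] /imsetP[W WG ->] /imsetP[v vV ->] /imsetP[w wW].
  by move=> /perm_inj vw; rewrite (inj _ _ _ VG WG vV) // vw.
Qed.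

(** A block can be gathered to an interval when its colour is eps-related to that
    of every point enclosed by it.  Exchanging a point of the block with a
    following point outside it moves the block to the right, so the sum of the
    distances to the right end decreases. *)
Lemma gather_block V s : V \in G -> allowed_perm eps d G s ->
  (forall x v v' : 'I_n, x \notin V -> v \in V -> v' \in V ->
     (s v < s x)%N -> (s x < s v')%N -> eps (d v) (d x)) ->
  exists2 s', allowed_perm eps d G s' & is_interval (s' @: V).
Proof.
move=> VG; have [m] := ubnP (\sum_(v in V) (n - s v)).
elim: m s => // m IH s; rewrite ltnS => sm aS sQ.
case/partitionPP: (pG) => ne sub cov inj.
have V0 : s @: V != set0 by have [v vV] := ne _ VG; apply/set0Pn; exists (s v);
  exact: imset_f.
have [iV|[i [i' [k [ii' /imsetP[v vV iv] i'V /imsetP[v' v'V kv] ik]]]]] :=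
  interval_or_gap V0.
  by exists s.
pose x := (s^-1)%g i'; have sx : s x = i' by rewrite permKV.
have xV : x \notin V by apply: contraNN i'V => xV; rewrite -sx imset_f.
have vx : v != x by apply: contraNneq xV => <-.
have e : eps (d v) (d x) 
    by apply: (sQ x v v') => //; rewrite sx -?kv // -iv ii'.
have sv'E u : u != v -> u != x -> (s * tperm i i')%g u = s u.
  move=> uv ux; rewrite permM tpermD //.
    by rewrite iv (inj_eq perm_inj) eq_sym.
  by rewrite -sx (inj_eq perm_inj) eq_sym.
have s'v : (s * tperm i i')%g v = i' by rewrite permM -iv tpermL.
have s'x : (s * tperm i i')%g x = i by rewrite permM sx tpermR.
apply: (IH (s * tperm i i')%g).
- apply: leq_trans sm; rewrite (bigD1 v) //= [X in (_ < X)%N](bigD1 v) //=.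
  rewrite s'v -iv ii' -addSn leq_add //; last first.
    apply: leq_sum => u /andP[uV uv]; rewrite sv'E //.
    by apply: contraNneq xV => <-.
  by rewrite ltn_sub2l // (ltn_trans _ (ltn_ord i')) ?ii'.
- apply: allowed_permM => //; split=> //.
    by rewrite /perm_deco iv permK -/x.
  have [dd|] := eqVneq (d v) (d x); [right|left]; last by rewrite /perm_deco iv
    permK.
  split; first by rewrite /perm_deco iv permK.
  have pp := partition_perm s; have tp := partition_trivIset pp.
  apply: contraNneq i'V => E.
  have : i' \in pblock (perm_part s G) i' by rewrite mem_pblock
    (cover_partition pp) inE.
  by rewrite -E (def_pblock (B := s @: V) tp) ?imset_f // iv imset_f.
- move=> y u u' yV uV u'V.
  have yv : y != v by apply: contraNneq yV => ->.
  have ux : u != x by apply: contraNneq xV => <-.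
  have u'x : u' != x by apply: contraNneq xV => <-.
  have de w : w \in V -> d w = d v by move=> wV; exact: mG wV vV.
  move=> uy yu'; have [->|yx] := eqVneq y x; first by rewrite (de u).
  have s'y : (s * tperm i i')%g y = s y by rewrite sv'E.
  have sy_v : s y <> s v :> nat by move/val_inj/perm_inj => E;
    rewrite E eqxx in yv.
  have iv' : s v = i :> nat by rewrite iv.
  apply: (sQ y u u') => //.
    move: uy; rewrite s'y; have [->|uv] := eqVneq u v; last by rewrite sv'E.
    by rewrite s'v ii' -iv'; exact: ltnW.
  move: yu'; rewrite s'y; have [->|uv] := eqVneq u' v; last by rewrite sv'E.
  by rewrite s'v ii' -iv' ltnS leq_eqVlt => /orP[/eqP|].
Qed.
End Perm.

(** Deleting the block V after the permutation s.  The map h sends a label of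
    the standardized partition back to the original point. *)
Section Delete.
Variables (n : nat) (d : 'I_n -> I) (G : {set {set 'I_n}}).
Hypotheses (pG : partition G [set: 'I_n]) (mG : monochromatic d G).
Variables (s : {perm 'I_n}) (V : {set 'I_n}).
Hypothesis VG : V \in G.

Let D := ~: (s @: V).
Let h (j : 'I_#|D|) : 'I_n := (s^-1)%g (enum_val j).
Let G' := std_delete (perm_part s G) (s @: V).
Let d' := restr (X := D) (perm_deco s d).

Let mem_h (U : {set 'I_n}) j : (enum_val j \in s @: U) = (h j \in U).
Proof. by rewrite -[enum_val j](permKV s) (mem_imset _ _ (@perm_inj _ s)). Qed.

Let h_notin j : h j \notin V.
Proof. by rewrite -mem_h; have := enum_valP j; rewrite inE. Qed.

Let h_surj x : x \notin V -> exists j, x = h j.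
Proof.
move=> xV; have xD : s x \in D by rewrite inE (mem_imset _ _ (@perm_inj _ s)).
by exists (enum_rank_in xD (s x)); rewrite /h enum_rankK_in // permK.
Qed.

Let G'_sub W : W \in G' ->
  exists2 U, U \in G :\ V & forall j, (j \in W) = (h j \in U).
Proof.
move=> /imsetP[Z /setD1P[UV /imsetP[U UG ZE]] ->]; subst Z.
exists U; last by move=> j; rewrite inE mem_h.
by rewrite !inE UG andbT; apply: contraNneq UV => ->.
Qed.

Let G'_sup U : U \in G :\ V ->
  exists2 W, W \in G' & forall j, (j \in W) = (h j \in U).
Proof.
move=> /setD1P[UV UG]; exists [set j | enum_val j \in s @: U].
  apply/imsetP; exists (s @: U) => //; rewrite !inE imset_f // andbT.
  by rewrite (inj_eq (imset_inj (@perm_inj _ s))).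
by move=> j; rewrite inE mem_h.
Qed.

Let disj U x : U \in G :\ V -> x \in U -> x \notin V.
Proof.
move=> /setD1P[UV UG] xU; case/partitionPP: (pG) => _ _ _ inj.
by apply: contraNN UV => xV; apply/eqP; exact: inj xU xV.
Qed.

Lemma std_delete_partition : partition G' [set: 'I_#|D|].
Proof.
case/partitionPP: (pG) => ne sub cov inj; apply/partitionPP; split.
- move=> W /G'_sub[U UG WE]; have [_ UG'] := setD1P UG.
  have [x xU] := ne _ UG'; have [j jx] := h_surj (disj UG xU).
  by exists j; rewrite WE -jx.
- by [].
- move=> j _; have [U UG jU] := cov (h j) (in_setT _).
  have [|W WG WE] := @G'_sup U; last by exists W; rewrite ?WE.
  by rewrite !inE UG andbT; apply: contraNneq (h_notin j) => <-.
- move=> W1 W2 j /G'_sub[U1 /setD1P[_ UG1] E1] /G'_sub[U2 /setD1P[_ UG2] E2].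
  rewrite E1 E2 => j1 j2; have e := inj _ _ _ UG1 UG2 j1 j2.
  by apply/setP => k; rewrite E1 E2 e.
Qed.

Lemma std_delete_mono : monochromatic d' G'.
Proof.
move=> W x y /G'_sub[U /setD1P[_ UG] E]; rewrite !E => xU yU.
exact: mG UG xU yU.
Qed.

Let pos_h (x y : 'I_#|D|) : (x < y)%N = (s (h x) < s (h y))%N.
Proof. by rewrite !permKV ltn_enum_val. Qed.

Let d_h j : d' j = d (h j).
Proof. by []. Qed.

Lemma std_delete_cross_ok : is_interval (s @: V) ->
  cross_ok eps (fun x : 'I_#|D| => val x) d' G' <->
    cross_ok eps (fun x => val (s x)) d G.
Proof.
move=> [l [r iV]].
have inV x : (x \in V) = (l <= s x < r)%N.
  by rewrite -(mem_imset _ _ (@perm_inj _ s)) iV inE.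
have between x y z : x \in V -> z \in V -> (s x < s y)%N -> (s y < s z)%N ->
  y \in V.
  rewrite !inV => /andP[lx _] /andP[_ zr] xy yz.
  by rewrite (leq_trans lx (ltnW xy)) (ltn_trans yz zr).
split=> gG; last first.
  apply: (@cross_ok_pull _ _ _ _ h (fun x => val (s x)) (fun x => val x) d d'
    pos_h d_h G G' _ gG).
  by move=> W /G'_sub[U /setD1P[_ UG] E]; exists U.
suff gD : cross_ok eps (fun x => val (s x)) d (G :\ V).
  case/partitionPP: (pG) => _ _ _ inj U W x y z w UG WG UW xU yW zU wW xy yz zw.
  have UV : U != V.
    apply: contraNneq UW => UV; apply/eqP; rewrite UV in xU zU *.
    by apply: (inj V W y) => //; exact: between xU zU xy yz.
  have WV : W != V.
    apply: contraNneq UW => WV; apply/eqP; rewrite WV in yW wW *.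
    by apply: (inj U V z) => //; exact: between yW wW yz zw.
  by apply: (gD U W x y z w) => //; rewrite !inE ?UV ?WV.
apply: (@cross_ok_push _ _ _ _ h (fun x => val (s x)) (fun x => val x) d d'
  pos_h d_h (G :\ V) G' _ gG) => U UG.
have [W WG WE] := G'_sup UG; exists W; split=> // x xU.
by have [j jx] := h_surj (disj UG xU); exists j.
Qed.

End Delete.

Lemma eps_reducible_cross_ok n (d : 'I_n -> I) (G : {set {set 'I_n}}) :
  eps_reducible eps d G -> partition G [set: 'I_n] -> monochromatic d G ->
  cross_ok eps (fun x : 'I_n => val x) d G.
Proof.
elim=> {n d G} [d _ _ V W ? ? ? ?|n d G s V aS VG iV _ IH pG mG].
  by rewrite inE.
apply/(allowed_perm_cross_ok mG aS)/(std_delete_cross_ok d pG VG iV).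
by apply: IH; [exact: std_delete_partition|exact: std_delete_mono].
Qed.

(** The interval spanned by V. *)
Definition hull n (V : {set 'I_n}) : {set 'I_n} :=
  [set x : 'I_n | [exists v in V, (v <= x)%N] && [exists v in V, (x <= v)%N]].

Lemma cross_ok_reducible n (d : 'I_n -> I) (G : {set {set 'I_n}}) :
  partition G [set: 'I_n] -> monochromatic d G ->
  cross_ok eps (fun x : 'I_n => val x) d G -> eps_reducible eps d G.
Proof.
have [m] := ubnP n; elim: m n d G => // m IH n d G; rewrite ltnS => nm pG mG gG.
case/partitionPP: (pG) => ne sub cov inj.
case: (posnP n) => [n0|n_gt0].
  subst n; suff -> : G = set0 by exact: eps_reducible_nil.
  by apply/setP => V; rewrite inE; apply/negP => /ne[[]].
(* V has minimal span; a point x that it encloses and that is not eps-related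
   to V would lie in a block U enclosed by V, which has a smaller span *)
have [V0 V0G _] := cov (Ordinal n_gt0) (in_setT _).
case: (arg_minnP (fun V : {set 'I_n} => #|hull V|) V0G) => V VG Vmin.
have hullP (U : {set 'I_n}) u : u \in U -> u \in hull U.
  by move=> uU; rewrite inE; apply/andP; split; apply/existsP; exists u;
    rewrite uU /=.
have [||s aS iV] := @gather_block n d G mG pG V 1%g VG.
- exact: allowed_perm1.
- move=> x v v' xV vV v'V; rewrite !perm1 => vx xv'.
  have [U UG xU] := cov x (in_setT _).
  have VU : V != U by apply: contraNneq xV => ->.
  apply/negPn/negP => bad.
  have inside u : u \in U -> (v < u)%N && (u < v')%N.
    move=> uU; apply/andP; split; rewrite ltnNge leq_eqVlt; apply/negP.
      move=> /orP[/eqP/val_inj uv|uv].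
        by case/eqP: VU; apply: (inj V U v) => //; rewrite -uv.
      have UV : U != V by rewrite eq_sym.
      have := gG _ _ _ _ _ _ UG VG UV uU vV xU v'V uv vx xv'.
      by rewrite (mG _ _ _ UG uU xU) heps (negbTE bad).
    move=> /orP[/eqP/val_inj uv|uv].
      by case/eqP: VU; apply: (inj V U v') => //; rewrite uv.
    have := gG _ _ _ _ _ _ VG UG VU vV xU v'V uU vx xv' uv.
    by rewrite (negbTE bad).
  have := Vmin _ UG; rewrite leqNgt => /negP; apply.
  apply: proper_card; rewrite properE; apply/andP; split.
    apply/subsetP => y; rewrite !inE =>
      /andP[/existsP[u /andP[uU uy]] /existsP[u' /andP[u'U yu']]].
    have /andP[vu _] := inside _ uU; have /andP[_ uv'] := inside _ u'U.
    apply/andP; split; apply/existsP; [exists v|exists v'].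
      by rewrite vV (leq_trans (ltnW vu)).
    by rewrite v'V (leq_trans yu') // ltnW.
  apply/subsetPn; exists v; first exact: hullP.
  rewrite inE; apply/nandP; left; apply/existsP => -[u /andP[uU uv]].
  by have /andP[vu _] := inside _ uU; rewrite leqNgt vu in uv.
apply: (eps_reducible_step aS VG iV); apply: IH.
- have [v vV] := ne _ VG; apply: leq_trans nm.
  rewrite -[X in (_ < X)%N]card_ord -cardsT; apply: proper_card.
  by rewrite properT; apply/eqP => /setP/(_ (s v)); rewrite !inE imset_f.
- exact: std_delete_partition.
- exact: std_delete_mono.
- by apply/(std_delete_cross_ok d pG VG iV)/(allowed_perm_cross_ok mG aS).
Qed.

Lemma eps_ncE n (d : 'I_n -> I) (G : {set {set 'I_n}}) :
  monochromatic d G ->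
  eps_nc eps d G = partition G [set: 'I_n] &&
    `[< cross_ok eps (fun x : 'I_n => val x) d G >].
Proof.
move=> mG; rewrite /eps_nc; case pG: (partition _ _) => //=.
by apply/asboolP/asboolP => [r|g];
  [exact: eps_reducible_cross_ok|exact: cross_ok_reducible].
Qed.

End EpsNoncrossingCrossings.

(** * The moment-cumulant formula for one colour *)

Section MomentCumulant.
Variables (K : fieldType) (A : algType K) (phi : {scalar A}).
Hypothesis hphi : phi 1 = 1.
Variables (I : eqType) (eps : I -> I -> bool).
Hypothesis heps : symmetric eps.
Variables (n : nat) (d : 'I_n -> I) (Z : {set 'I_n}).
Hypothesis dZ : forall x y, x \in Z -> y \in Z -> d x = d y.

Let up (W : {set 'I_#|Z|}) : {set 'I_n} := [set enum_val j | j in W].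
Let down (V : {set 'I_n}) : {set 'I_#|Z|} := [set j | enum_val j \in V].

Let mem_up W j : (enum_val j \in up W) = (j \in W).
Proof. by rewrite (mem_imset _ _ enum_val_inj). Qed.

Let upK : cancel up down.
Proof. by move=> W; apply/setP => j; rewrite inE mem_up. Qed.

Let up_sub W : up W \subset Z.
Proof. by apply/subsetP => _ /imsetP[j _ ->]; exact: enum_valP. Qed.

Let Z_surj x : x \in Z -> exists j : 'I_#|Z|, x = enum_val j.
Proof. by move=> xZ; exists (enum_rank_in xZ x); rewrite enum_rankK_in. Qed.

Let downK (V : {set 'I_n}) : V \subset Z -> up (down V) = V.
Proof.
move=> /subsetP VZ; apply/setP => x; apply/imsetP/idP => [[j + ->]|xV].
  by rewrite inE.
by have [j jx] := Z_surj (VZ _ xV); exists j; rewrite // inE -jx.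
Qed.

Let eps_nc_up (G' : {set {set 'I_#|Z|}}) :
  eps_nc eps (restr (X := Z) d) G' =
  partition (up @: G') Z && `[< cross_ok eps (fun x : 'I_n => val x) d
    (up @: G') >].
Proof.
have mZ G : monochromatic (restr (X := Z) d) G.
  by move=> V x y _ _ _; apply: dZ; exact: enum_valP.
rewrite eps_ncE //; congr (_ && _).
  apply/partitionPP/partitionPP => -[ne sub cov inj]; split.
  - by move=> _ /imsetP[W WG ->]; have [j jW] := ne _ WG; exists (enum_val j);
    rewrite mem_up.
  - by move=> _ x /imsetP[W WG ->] /(subsetP (up_sub W)).
  - move=> x /Z_surj[j ->]; have [W WG jW] := cov j (in_setT _).
    by exists (up W); [exact: imset_f|rewrite mem_up].
  - move=> _ _ x /imsetP[V VG ->] /imsetP[W WG ->] /[dup] /(subsetP (up_sub V)).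
    by move=> /Z_surj[j ->]; rewrite !mem_up => jV jW;
      rewrite (inj _ _ _ VG WG jV jW).
  - move=> W WG; have [x] := ne _ (imset_f up WG).
    by move=> /imsetP[j jW _]; exists j.
  - by [].
  - move=> j _; have [_ /imsetP[W WG ->]] := cov _ (enum_valP j).
    by rewrite mem_up; exists W.
  - move=> V W j VG WG jV jW; apply: (can_inj upK).
    by apply: (inj _ _ (enum_val j)); rewrite ?imset_f ?mem_up.
have pos_h (x y : 'I_#|Z|) : (x < y)%N = (enum_val x < enum_val y)%N.
  by rewrite ltn_enum_val.
apply/asboolP/asboolP => gG.
  apply: (@cross_ok_push _ _ _ _ enum_val (fun x : 'I_n => val x)
    (fun x : 'I_#|Z| => val x) d _ pos_h (fun=> erefl) _ _ _ gG).
  move=> _ /imsetP[W WG ->]; exists W; split=> // x; rewrite ?mem_up //.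
  by move=> /(subsetP (up_sub W)) /Z_surj.
apply: (@cross_ok_pull _ _ _ _ enum_val (fun x : 'I_n => val x)
  (fun x : 'I_#|Z| => val x) d _ pos_h (fun=> erefl) _ _ _ gG).
by move=> W WG; exists (up W); [exact: imset_f|move=> x; rewrite mem_up].
Qed.

(** The formula defining the eps-cumulants of the word at Z, transported along
    the increasing enumeration of Z. *)
Lemma moment_monochromatic (a : 'I_n -> A) :
  moment phi a Z =
  \sum_(P | partition P Z && `[< cross_ok eps (fun x : 'I_n => val x) d P >])
    \prod_(V in P) block_cumulant phi eps d a V.
Proof.
have [Z0|Z0] := eqVneq Z set0.
  rewrite /moment Z0 big_set0 hphi (big_pred1 set0) ?big_set0 // => P.
  rewrite partition_set0; apply: andb_idr => /eqP ->; apply/asboolP.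
  by move=> V W ? ? ? ?; rewrite inE.
rewrite /moment prod_enum_val.
rewrite (eps_cumulant_moment phi eps (restr (X := Z) d) (restr (X := Z) a))
  ?card_gt0 //.
rewrite [RHS](reindex_onto (fun G' : {set {set 'I_#|Z|}} => up @: G')
  (fun P : {set {set 'I_n}} => down @: P)) /=; last first.
  move=> P /andP[pP _]; rewrite -imset_comp -[RHS]imset_id; apply:
    eq_in_imset => V VP.
  by rewrite /= downK //; exact: partitionS pP VP.
apply: eq_big => [G'|G' _].
  rewrite eps_nc_up -imset_comp (eq_imset (g := id)) ?imset_id ?eqxx ?andbT //.
rewrite /eps_cumulant_part big_imset /=; last by move=> V W _ _; exact:
  (can_inj upK).
apply: eq_bigr => W _; rewrite /block_cumulant.
by rewrite (restr_imset_incr W (fun k d a => eps_cumulant phi eps d a) _ _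
  (@ltn_enum_val _ Z)).
Qed.

End MomentCumulant.

(** * Cumulants for a constant decoration *)

Section ConstantDecoration.
Variables (K : fieldType) (A : algType K) (phi : {scalar A}).
Variables (I : eqType) (eps : I -> I -> bool).
Hypothesis heps : symmetric eps.

Lemma noncrossing_cross_ok n (i : I) (d : 'I_n -> I) (G : {set {set 'I_n}}) :
  (forall j, d j = i) -> ~~ eps i i ->
  `[< cross_ok eps (fun x : 'I_n => val x) d G >] = noncrossing G.
Proof.
move=> di /negbTE ei; apply/asboolP/idP => [gG|/forall_inP nc].
  apply/forall_inP => V VG; apply/forall_inP => W WG; apply/implyP => VW.
  apply/forall_inP => x xV; apply/forall_inP => y yW.
  apply/forall_inP => z zV; apply/forall_inP => w wW.
  apply/and3P => -[xy yz zw].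
  by have := gG _ _ _ _ _ _ VG WG VW xV yW zV wW xy yz zw; rewrite !di ei.
move=> V W x y z w VG WG VW xV yW zV wW xy yz zw.
have /forall_inP/(_ W WG)/implyP/(_ VW)/forall_inP/(_ x xV) := nc V VG.
move=> /forall_inP/(_ y yW)/forall_inP/(_ z zV)/forall_inP/(_ w wW).
by rewrite xy yz zw.
Qed.

Lemma eps_nc_const n (i : I) (d : 'I_n -> I) (G : {set {set 'I_n}}) :
  (forall j, d j = i) ->
  eps_nc eps d G = partition G [set: 'I_n] && (eps i i || noncrossing G).
Proof.
move=> di; rewrite eps_ncE //; last by move=> V x y *; rewrite !di.
congr (_ && _); case ei: (eps i i) => /=.
  by apply/asboolP => V W x y *; rewrite !di.
by rewrite (noncrossing_cross_ok _ di) ?ei.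
Qed.

(** The cumulants of words of colour i depend only on the partitions selected
    for the constant decoration i. *)
Lemma eq_cumulant_rec (J : Type)
    (S : forall m, ('I_m -> I) -> {set {set 'I_m}} -> bool)
    (S' : forall m, ('I_m -> J) -> {set {set 'I_m}} -> bool) (i : I) (i' : J) :
  (forall m (d : 'I_m -> I) G, (forall j, d j = i) -> S m d G =
    S' m (fun=> i') G) ->
  forall k n (d : 'I_n -> I) (a : 'I_n -> A), (forall j, d j = i) ->
  cumulant_rec phi S k d a = cumulant_rec phi S' k (fun=> i') a.
Proof.
move=> SS'; elim=> //= k IH n d a di; congr (_ - _).
apply: eq_big => [G|G _]; first by rewrite SS'.
by apply: eq_bigr => V _; apply: IH => j; exact: di.
Qed.

Lemma eps_cumulant_const n (i : I) (d : 'I_n -> I) (a : 'I_n -> A) :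
  (forall j, d j = i) ->
  eps_cumulant phi eps d a =
    if eps i i then classical_cumulant phi a else free_cumulant phi a.
Proof.
move=> di; case ei: (eps i i); apply: eq_cumulant_rec di => m d' G d'i;
by rewrite (eps_nc_const _ d'i) ei ?andbT.
Qed.

End ConstantDecoration.

(** Lying below the kernel of the decoration means having blocks of one colour. *)
Lemma refines_kerP (I : eqType) n (d : 'I_n -> I) (G : {set {set 'I_n}}) :
  partition G [set: 'I_n] ->
  reflect (monochromatic d G) (refines G (preim_partition d [set: 'I_n])).
Proof.
case/partitionPP => ne _ _ _.
apply: (iffP forall_inP) => [ref V x y VG xV yV|mG V VG].
  have /exists_inP[W /imsetP[z _ ->] /subsetP VW] := ref V VG.
  by move: (VW _ xV) (VW _ yV); rewrite !inE /= => /eqP <- /eqP <-.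
have [x xV] := ne _ VG; apply/exists_inP.
exists [set y in [set: 'I_n] | d x == d y].
  by apply/imsetP; exists x; rewrite ?inE.
by apply/subsetP => y yV; rewrite !inE /=; apply/eqP; exact: mG VG xV yV.
Qed.

Theorem corollary14
  (K : fieldType) (hK : [pchar K] =i pred0)
  (A : algType K) (phi : {scalar A}) (hphi : phi 1 = 1)
  (I : eqType) (eps : I -> I -> bool) (heps : symmetric eps)
  (B : I -> {pred A}) (hB : forall i, GRing.subalg_closed (B i))
  (hind : eps_independent phi eps B)
  (n : nat) (hn : (0 < n)%N) (d : 'I_n -> I)
  (a : 'I_n -> A) (ha : forall j, a j \in B (d j)) :
  phi (\prod_(j < n) a j) =
    \sum_(G : {set {set 'I_n}} |
            eps_nc eps d G && refines G (preim_partition d [set: 'I_n]))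
      eps_cumulant_part phi eps d a G
  /\
  (forall G : {set {set 'I_n}},
     eps_nc eps d G -> refines G (preim_partition d [set: 'I_n]) ->
     forall (V : {set 'I_n}) (i : I),
       V \in G -> (forall v, v \in V -> d v = i) ->
       eps_cumulant phi eps (restr (X := V) d) (restr (X := V) a) =
         if eps i i then classical_cumulant phi (restr (X := V) a)
         else free_cumulant phi (restr (X := V) a)).
Proof.
split; last first.
  move=> G _ _ V i _ dV; apply: eps_cumulant_const => // j.
  by apply: dV; exact: enum_valP.
transitivity (moment phi a [set: 'I_n]).
  by congr (phi _); apply: eq_bigl => j; rewrite inE.
have momE (a' : 'I_n -> A) (Z : {set 'I_n}) := fun dZ =>
  @moment_monochromatic K A phi hphi I eps heps n d Z dZ a'.
rewrite (moment_cumulant_sum hphi heps momE hB hind) //.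
apply: eq_bigl => G; rewrite /admissible.
case pG: (partition G [set: 'I_n]); last by rewrite /eps_nc pG.
case: (refines_kerP d pG) => [mG|nmG].
  rewrite eps_ncE // pG andbT /=.
  by apply/asboolP/asboolP => [[]|].
by rewrite andbF /=; apply/asboolP => -[].
Qed.
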